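(* Let $f(x,t)$ be the series $$f(x,t)=\hat f^{(0)}(t)+\epsilon\hat f^{(1)}(t)\exp(\mathrm{i}kx)+\epsilon^2\hat f^{(2)}(t)\exp(2\mathrm{i}kx)+\cdots = \sum_{m\geq 0}\epsilon^m\hat f^{(m)}(t)\exp(\mathrm{i}mkx),$$ where $\hat f^{(0)}(t)\equiv(1,0,\dots,0)^T\in\mathbb{C}^{M+1}$ and the functions $\hat f^{(m)}=(\hat f^{(m)}_0,\dots,\hat f^{(m)}_M)^T:[0,\infty)\to\mathbb{C}^{M+1}$, $m\geq 1$, are the solutions of $$\frac{\mathrm{d}\hat f^{(1)}}{\mathrm{d}t}+\mathrm{i}k\Big(A+\frac{1}{k^2}G\Big)\hat f^{(1)}=H\hat f^{(1)},\qquad \hat f^{(1)}(0)=(1,0,\dots,0)^T,$$ and, for $m\geq 2$, $$\frac{\mathrm{d}\hat f^{(m)}}{\mathrm{d}t}+\mathrm{i}mk\Big(A+\frac{1}{(mk)^2}G\Big)\hat f^{(m)}+\frac{\mathrm{i}}{k}\sum_{l=1}^{m-1}\frac1l\hat f^{(l)}_0 B\hat f^{(m-l)}=H\hat f^{(m)},\qquad \hat f^{(m)}(0)=0.$$ Then there exist constants $C^{(3)}$ and $\lambda^{(1)}>0$ such that, if $\epsilon>0$ is sufficiently small, the series converges in $[L^2(0,D)]^{M+1}$ for every $t\geq 0$ and $$\|f(\cdot,t)-\hat f^{(0)}\|_2\leq C^{(3)}(t^M+1)\exp(-\lambda^{(1)}t)\qquad\text{for all } t\geq 0.$$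
   Context: Let $M \geq 1$ be an integer, $D>0$ and $k = 2\pi/D$. Rows and columns of $(M+1)\times(M+1)$ matrices are indexed from $1$ to $M+1$. The matrix $A$ is the real symmetric tridiagonal matrix with zero diagonal and $A_{n,n+1}=A_{n+1,n}=\sqrt{n}$, $n=1,\dots,M$; the matrix $B$ has entries $B_{n+1,n}=\sqrt{n}$, $n=1,\dots,M$, and all other entries zero; the matrix $G$ has its entry in the second row and first column equal to $1$ and all other entries zero. The filter matrix $H = \mathrm{diag}\{h_0,h_1,\dots,h_M\}$ is real diagonal with $h_i \leq 0$ for all $i$, $h_0 = 0$ and $h_M\neq 0$. Here $\|f(\cdot,t)\|_2$ is the $[L^2(0,D)]^{M+1}$ norm in $x$, so that $\|\sum_m c^{(m)}\exp(\mathrm{i}mkx)\|_2^2=D\sum_m\|c^{(m)}\|_2^2$ for $c^{(m)}\in\mathbb{C}^{M+1}$. *)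

(* Defs.v *)
From HB Require Import structures.
From mathcomp Require Import all_boot all_order all_algebra.
From mathcomp Require Import complex.
From mathcomp Require Import all_classical all_reals all_analysis.
Set Implicit Arguments.
Unset Strict Implicit.
Unset Printing Implicit Defensive.
Import Order.TTheory GRing.Theory Num.Theory.
Import numFieldNormedType.Exports.
Local Open Scope classical_set_scope.
Local Open Scope ring_scope.
Local Open Scope complex_scope.

Section Matrices.
Context {R : realType} (M : nat).

(* Rows and columns are numbered from 0 here, from 1 in the usual presentation:
   the pair (n, n+1) there is the pair (n-1, n) here, hence the entry is the
   square root of the larger of the two indices. *)
Definition matA : 'M[R]_M.+1 :=
  \matrix_(i, j) (if j == i.+1 :> nat then Num.sqrt j%:R
                  else if i == j.+1 :> nat then Num.sqrt i%:R else 0).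

Definition matB : 'M[R]_M.+1 :=
  \matrix_(i, j) (if i == j.+1 :> nat then Num.sqrt i%:R else 0).

Definition matG : 'M[R]_M.+1 :=
  \matrix_(i, j) (if (i == 1%N :> nat) && (j == 0%N :> nat) then 1 else 0).

Definition e0 : 'cV[R[i]]_M.+1 := delta_mx ord0 ord0.

End Matrices.

Definition cmx {R : realType} m n (A : 'M[R]_(m, n)) : 'M[R[i]]_(m, n) :=
  map_mx (fun a => a%:C) A.

Definition cexpi {R : realType} (theta : R) : R[i] := cos theta +i* sin theta.

Section Calculus.
Context {R : realType}.

(* At a point of S that is not interior (t = 0 for S = [0, +oo[) this is the
   one-sided derivative; no value of g outside S is involved when t is in S. *)
Definition is_deriv_within (S : set R) (g : R -> R) (t l : R) : Prop :=
  (g s - g t) / (s - t) @[s --> within S t^'] --> l.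

(* R[i] is not a normed module over R in the library, so differentiation with
   respect to a real variable is done on real and imaginary parts. *)
Definition is_vderiv_within n (S : set R) (f : R -> 'cV[R[i]]_n) (t : R)
    (l : 'cV[R[i]]_n) : Prop :=
  forall i, is_deriv_within S (fun s => complex.Re (f s i 0)) t (complex.Re (l i 0)) /\
            is_deriv_within S (fun s => complex.Im (f s i 0)) t (complex.Im (l i 0)).

Definition enorm n (v : 'cV[R[i]]_n) : R :=
  Num.sqrt (\sum_i (complex.Re (v i 0) ^+ 2 + complex.Im (v i 0) ^+ 2)).

Definition L2norm n (D : R) (f : R -> 'cV[R[i]]_n) : \bar R :=
  Lnorm (mrestr (@lebesgue_measure R) (measurable_itv `]0, D[)) 2%:E
    (fun x => (enorm (f x))%:E).

Definition inL2 n (D : R) (f : R -> 'cV[R[i]]_n) : Prop :=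
  (forall i, measurable_fun `]0, D[ (fun x => complex.Re (f x i 0)) /\
             measurable_fun `]0, D[ (fun x => complex.Im (f x i 0))) /\
  (L2norm D f < +oo)%E.

Definition L2cvg n (D : R) (u : nat -> R -> 'cV[R[i]]_n)
    (f : R -> 'cV[R[i]]_n) : Prop :=
  L2norm D (fun x => u N x - f x) @[N --> \oo] --> 0%E.

Definition fourier_sum n (k eps : R) (c : nat -> 'cV[R[i]]_n) (N : nat) (x : R)
    : 'cV[R[i]]_n :=
  \sum_(m < N) ((eps ^+ m)%:C * cexpi (m%:R * k * x)) *: c m.

End Calculus.

(* Main.v *)
Require Import Defs.
From HB Require Import structures.
From mathcomp Require Import all_boot all_order all_algebra.
From mathcomp Require Import complex.
From mathcomp Require Import all_classical all_reals all_analysis.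
From mathcomp Require Import measurable_realfun ring lra zify.
Import Order.TTheory GRing.Theory Num.Theory.
Import numFieldNormedType.Exports.
Local Open Scope classical_set_scope.
Local Open Scope ring_scope.
Local Open Scope complex_scope.

(* Put kappa = m k. Multiplying the component f_j by i^j, and f_0 moreover by
   sqrt (1 + 1/kappa^2), turns the m-th equation into y' = (H + kappa S) y + source
   with S real, tridiagonal and antisymmetric: |y|^2 is dissipated by H alone,
   possibly only through y_M. Subtracting small multiples of y_j y_(j+1) / kappa
   from |y|^2 gives a Lyapunov form whose dissipation controls every component,
   with constants independent of kappa >= k (hypocoercivity), so that all the
   linear parts decay at one common rate. The quadratic source decays twice as
   fast, whence |fhat m| <= gam rho^m m^-2 exp (- mu t) by induction on m, because
   the sequence m^-2 is stable under convolution up to a constant. For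
   eps rho <= 1/2 the series is then dominated, uniformly in x, by a geometric
   one, and a sup bound on a bounded interval gives the L2 bound. *)

(** * Energy and Lyapunov forms of a dissipative antisymmetric chain *)

Definition sumsq (R : realFieldType) (n : nat) (z : nat -> R) : R :=
  \sum_(j < n) z j ^+ 2.

Definition chain_form (R : realFieldType) (M : nat) (delta : nat -> R) (kappa : R)
    (z : nat -> R) : R :=
  sumsq R M.+1 z - kappa^-1 * \sum_(j < M) delta j * (z j * z j.+1).

Definition chain_form_deriv (R : realFieldType) (M : nat) (delta : nat -> R)
    (kappa : R) (z v : nat -> R) : R :=
  \sum_(j < M.+1) 2 * (z j * v j)
  - kappa^-1 * \sum_(j < M) delta j * (v j * z j.+1 + z j * v j.+1).

(* [z j.-1] is junk for [j = 0]; it is only used with [beta 0 = 0], just as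
   [z M.+1] is only used with [beta M.+1 = 0]. *)
Definition chain_field (R : realFieldType) (h beta : nat -> R) (kappa : R)
    (z : nat -> R) (j : nat) : R :=
  h j * z j + kappa * (beta j * z j.-1 - beta j.+1 * z j.+1).

(** The coupling is antisymmetric, so its contributions telescope to two boundary terms. These
    vanish when [beta 0] and [beta n.+1] are zero, and then only [h] changes the energy. *)
Lemma sum_chain_field_mul (R : realFieldType) (n : nat) (h beta : nat -> R)
    (kappa : R) (z : nat -> R) :
  \sum_(j < n.+1) z j * chain_field R h beta kappa z j =
  \sum_(j < n.+1) h j * z j ^+ 2
  + kappa * (beta 0%N * z 0%N ^+ 2 - beta n.+1 * (z n * z n.+1)).
Proof.
elim: n => [|n IH]; first by rewrite !big_ord_recl !big_ord0 /chain_field /=; ring.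
by rewrite big_ord_recr IH [in RHS]big_ord_recr /= /chain_field /=; ring.
Qed.

Lemma sumsq_ge0 (R : realFieldType) (n : nat) (z : nat -> R) : 0 <= sumsq R n z.
Proof. by apply: sumr_ge0 => i _; apply: sqr_ge0. Qed.

Lemma sqr_le_sum (R : realFieldType) (n : nat) (z : nat -> R) (j : nat) :
  (j < n)%N -> z j ^+ 2 <= sumsq R n z.
Proof.
move=> jn; rewrite /sumsq (bigD1 (Ordinal jn)) //= lerDl sumr_ge0 // => i _.
exact: sqr_ge0.
Qed.

(* The exponent is minus a strictly convex function of j, up to a constant. Hence
   w_j^2 is small compared with w_(j-1) w_(j+1), which is what lets the diagonal
   dissipation absorb the terms z_(j-1) z_(j+1) that all have the order kappa^0. *)
Definition chain_weight (R : realFieldType) (M : nat) (q : R) (j : nat) : R :=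
  q ^+ (M * M.+1 - j * j.+1).

(** The exponents are integers, so the strict inequality is worth at least one factor [q]. The
    bounds on [a] and [b] keep the truncated subtractions exact, also the one for [j]. *)
Lemma chain_weight_step (R : realFieldType) (M : nat) (q : R) (j a b : nat) :
  0 < q <= 1 -> (a <= M)%N -> (b <= M)%N -> (a * a.+1 + b * b.+1 > j * j.+1 + j * j.+1)%N ->
  chain_weight R M q j ^+ 2 <= q * (chain_weight R M q a * chain_weight R M q b).
Proof.
move=> /andP[q0 q1] aM bM ab; rewrite /chain_weight -exprM -exprD -exprS.
have aM' : (a * a.+1 <= M * M.+1)%N by apply: leq_mul.
have bM' : (b * b.+1 <= M * M.+1)%N by apply: leq_mul.
apply: ler_wiXn2l => //; first exact: ltW.
lia.
Qed.

Lemma norm_mul_le (R : realFieldType) (S a b : R) :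
  a ^+ 2 <= S -> b ^+ 2 <= S -> `|a * b| <= S.
Proof. by move=> aS bS; rewrite ler_norml; apply/andP; split; nra. Qed.

(** Because [w <= q * (wa * wb)], the weight can be shared between the two components, each of which
    is then controlled by [S]; the remaining factor [q] makes the term small. *)
Lemma cross_term_le (R : realFieldType) (q B S c w wa wb za zb : R) :
  0 <= q -> 0 <= c <= B -> 0 <= wa -> 0 <= wb -> 0 <= w <= q * (wa * wb) ->
  (wa * za) ^+ 2 <= S -> (wb * zb) ^+ 2 <= S ->
  `|c * w * (za * zb)| <= q * B * S.
Proof.
move=> q0 /andP[c0 cB] wa0 wb0 /andP[w0 wq] ha hb.
have S0 : 0 <= S by apply: le_trans ha; apply: sqr_ge0.
have h1 : `|za * zb| * (wa * wb) <= S.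
  rewrite -[wa * wb]ger0_norm ?mulr_ge0 // -normrM.
  have -> : za * zb * (wa * wb) = (wa * za) * (wb * zb) by ring.
  exact: norm_mul_le.
rewrite normrM ger0_norm ?mulr_ge0 //.
apply: (@le_trans _ _ (B * (q * (wa * wb)) * `|za * zb|)).
  by apply: ler_wpM2r => //; apply: ler_pM.
rewrite (_ : _ * _ = q * B * (`|za * zb| * (wa * wb))); last by ring.
by apply: ler_wpM2l => //; apply: mulr_ge0 => //; lra.
Qed.

Lemma weighted_young (R : realFieldType) (c theta a b : R) : 0 <= c -> 0 < theta ->
  `|c * (a * b)| <= theta * a ^+ 2 + c ^+ 2 / theta * b ^+ 2.
Proof.
move=> c0 t0; have tn : theta != 0 by rewrite gt_eqF.
have -> : theta * a ^+ 2 + c ^+ 2 / theta * b ^+ 2 =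
  theta * (a ^+ 2 + (c / theta * b) ^+ 2) by field.
have -> : c * (a * b) = theta * (a * (c / theta * b)) by field.
rewrite normrM gtr0_norm // ler_pM2l // ler_norml.
by move: (c / theta * b) => d; apply/andP; split; nra.
Qed.

Lemma chain_weight_gt0 (R : realFieldType) (M : nat) (q : R) (j : nat) :
  0 < q -> 0 < chain_weight R M q j.
Proof. exact: exprn_gt0. Qed.

Lemma chain_weight_le1 (R : realFieldType) (M : nat) (q : R) (j : nat) :
  0 < q <= 1 -> chain_weight R M q j <= 1.
Proof. by move=> /andP[q0 q1]; apply: exprn_ile1 => //; apply: ltW. Qed.

(** The mixed terms amount to at most [M%:R * q / kappa] times the sum of squares, and [kappa >= k]
    makes this factor at most one half. *)
Lemma chain_form_equiv (R : realFieldType) (M : nat) (q k kappa : R) (z : nat -> R) :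
  0 < q <= 1 -> 0 < k <= kappa -> M%:R * q <= k / 2 ->
  sumsq R M.+1 z / 2
    <= chain_form R M (fun j => chain_weight R M q j ^+ 2) kappa z
    <= 2 * sumsq R M.+1 z.
Proof.
move=> hq /andP[k0 kk] hMq; set Z := sumsq _ _ _; set Q := chain_form _ _ _ _ _.
have /andP[q0 q1] := hq.
have Z0 : 0 <= Z by apply: sumsq_ge0.
have kap0 : 0 < kappa by apply: lt_le_trans kk.
suff : `|Q - Z| <= Z / 2 by rewrite ler_norml; lra.
rewrite /Q /chain_form -/Z addrC addKr normrN normrM gtr0_norm ?invr_gt0 //.
rewrite ler_pdivrMl //.
apply: (@le_trans _ _ (\sum_(j < M) q * Z)).
  apply: le_trans (ler_norm_sum _ _ _) _; apply: ler_sum => -[j /= jM] _.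
  have h1 : z j ^+ 2 <= Z by apply: (@sqr_le_sum _ M.+1 z j); apply: leqW.
  have h2 : z j.+1 ^+ 2 <= Z by exact: (@sqr_le_sum _ M.+1 z j.+1).
  (* Only indices below [M] occur in the mixed terms; the weight at [M] is 1 and would not be
     small. *)
  have wq : chain_weight R M q j ^+ 2 <= q.
    apply: le_trans (@chain_weight_step _ M q j j.+1 j.+1 hq jM jM _) _; first by clear; lia.
    rewrite -[leRHS]mulr1 ler_wpM2l ?(ltW q0) // mulr_ile1 ?chain_weight_le1 //;
    exact/ltW/chain_weight_gt0.
  rewrite normrM ger0_norm ?sqr_ge0 //; apply: ler_pM; rewrite ?sqr_ge0 //.
  exact: norm_mul_le.
rewrite sumr_const card_ord -[_ *+ M]mulr_natl mulrA.
apply: (@le_trans _ _ (k / 2 * Z)); first exact: ler_wpM2r.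
by rewrite mulrC [leRHS]mulrC -mulrA; apply: ler_wpM2l => //; lra.
Qed.

(** Differentiating the product [z j * z j.+1] produces the square of [z j] with a good sign for
    [j < M], and the damping [h M] supplies the missing square of [z M]. Every other coupling term
    carries a spare factor [q]; source terms are split by Young's inequality with parameter
    [theta]. *)
Lemma chain_form_deriv_le (R : realFieldType) (M : nat) (h beta : nat -> R)
    (B H c q k kappa theta : R) (z g : nat -> R) :
  0 < q <= 1 -> 0 < k <= kappa -> 1 <= B -> 0 < theta ->
  (forall j, (j <= M)%N -> - H <= h j <= 0) -> 0 < c <= 1 -> 2 * h M <= - c ->
  M%:R * (q * (5 * B + 2 * (H / k))) <= c / 2 ->
  beta 0%N = 0 -> beta M.+1 = 0 ->
  (forall j, (1 <= j <= M)%N -> 1 <= beta j <= B) ->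
  chain_form_deriv R M (fun j => chain_weight R M q j ^+ 2) kappa z
    (fun j => chain_field R h beta kappa z j + g j)
  <= - (c / 2) * sumsq R M.+1 (fun j => chain_weight R M q j * z j)
     + (1 + 2 * M%:R) * (theta * sumsq R M.+1 z)
     + (theta^-1 + 2 * M%:R * (k^-1 ^+ 2 / theta)) * sumsq R M.+1 g.
Proof.
move=> hq /andP[k0 kk] B1 t0 hh /andP[c0 c1] hM hMq b0 bM hb.
have /andP[q0 q1] := hq.
set s := chain_weight R M q; set U := sumsq _ _ _; set Z := sumsq _ _ z; set G := sumsq _ _ g.
have kap0 : 0 < kappa by apply: lt_le_trans kk.
have kapn : kappa != 0 by rewrite gt_eqF.
have hi0 : - H <= 0 by have := hh 0%N isT; lra.
have s0 j : 0 < s j by exact: chain_weight_gt0.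
have s1 j : s j <= 1 by exact: chain_weight_le1.
have uU j : (j <= M)%N -> (s j * z j) ^+ 2 <= U.
  exact: (@sqr_le_sum _ M.+1 (fun j => s j * z j) j).
have zZ j : (j <= M)%N -> z j ^+ 2 <= Z by exact: (@sqr_le_sum _ M.+1 z j).
have gG j : (j <= M)%N -> g j ^+ 2 <= G by exact: (@sqr_le_sum _ M.+1 g j).
have U0 : 0 <= U by apply: le_trans (uU 0%N isT); apply: sqr_ge0.
have beta0 j : (1 <= j <= M)%N -> 0 <= beta j <= B.
  by move=> /hb /andP[b1 ->]; rewrite (le_trans _ b1).
have BU : 0 <= q * B * U.
  by rewrite mulr_ge0 // mulr_ge0 ?(ltW q0) // (le_trans _ B1).
have kinv : 0 <= kappa^-1 <= k^-1.
  by rewrite invr_ge0 (ltW kap0) /= lef_pV2 // posrE.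
(* [T j] is the weighted derivative of the product [z j * z j.+1] along the flow with source. *)
pose T j := s j ^+ 2 * ((chain_field R h beta kappa z j + g j) * z j.+1
   + z j * (chain_field R h beta kappa z j.+1 + g j.+1)).
have cross a b c' j : (a <= M)%N -> (b <= M)%N ->
  (a * a.+1 + b * b.+1 > j * j.+1 + j * j.+1)%N -> forall B', 0 <= c' <= B' ->
  `|c' * s j ^+ 2 * (z a * z b)| <= q * B' * U.
  move=> aM bM' ab B' cB; apply: (@cross_term_le _ _ _ _ _ _ (s a) (s b));
    rewrite ?(ltW q0) ?(ltW (s0 _)) ?uU // sqr_ge0 /=.
  exact: chain_weight_step.
have young a b j : (a <= M)%N -> (b <= M)%N ->
  `|kappa^-1 * s j ^+ 2 * (z a * g b)| <= theta * Z + k^-1 ^+ 2 / theta * G.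
  move=> aM bM'; have sj : s j ^+ 2 <= 1 by rewrite exprn_ile1 // ltW.
  rewrite -mulrA mulrCA mulrA -mulrA.
  rewrite normrM ger0_norm ?sqr_ge0 //.
  apply: (@le_trans _ _ (1 * `|k^-1 * (z a * g b)|)).
    apply: ler_pM; rewrite ?sqr_ge0 // !normrM ler_wpM2r ?mulr_ge0 //.
    have /andP[ki0 kl] := kinv.
    by rewrite (ger0_norm ki0) ger0_norm // invr_ge0 ltW.
  rewrite mul1r; apply: le_trans (weighted_young _ _ _ _ _ _ t0) _; first by rewrite invr_ge0 ltW.
  apply: lerD; apply: ler_wpM2l; rewrite ?zZ ?gG ?(ltW t0) //.
  by rewrite divr_ge0 ?sqr_ge0 // ltW.
have Tle j : (j < M)%N ->
  - (kappa^-1 * T j) <= - (s j * z j) ^+ 2 + q * (5 * B + 2 * (H / k)) * U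
     + 2 * (theta * Z + k^-1 ^+ 2 / theta * G).
  move=> jM.
  (* The [kappa] of the coupling cancels against [kappa^-1], so the coupling terms no longer depend
     on [kappa]. The first term is the gained dissipation; the others are errors to be absorbed. *)
  have -> : kappa^-1 * T j = beta j.+1 * (s j * z j) ^+ 2
     - beta j.+1 * s j ^+ 2 * (z j.+1 * z j.+1)
     + beta j * s j ^+ 2 * (z j.-1 * z j.+1)
     - beta j.+2 * s j ^+ 2 * (z j * z j.+2)
     - (kappa^-1 * (- (h j + h j.+1))) * s j ^+ 2 * (z j * z j.+1)
     + kappa^-1 * s j ^+ 2 * (z j.+1 * g j) + kappa^-1 * s j ^+ 2 * (z j * g j.+1).
    by rewrite /T /chain_field /=; field.
  have e1 : (s j * z j) ^+ 2 <= beta j.+1 * (s j * z j) ^+ 2.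
    by rewrite ler_peMl ?sqr_ge0 //; have /andP[] := hb j.+1 jM.
  have e2 : `|beta j.+1 * s j ^+ 2 * (z j.+1 * z j.+1)| <= q * B * U.
    by apply: cross; rewrite ?beta0 //; clear; lia.
  (* Here the indices [j - 1] and [j + 1] lie on both sides of [j], and strict convexity of j(j+1)
     is essential. At [j = 0] the predecessor is a default value, cancelled by [beta 0 = 0]. *)
  have e3 : `|beta j * s j ^+ 2 * (z j.-1 * z j.+1)| <= q * B * U.
    have [j0|j0] := posnP j; last first.
      apply: cross; rewrite ?beta0 ?j0 ?(ltnW jM) //; last first.
        by clear -j0; case: j j0 => [//|i _] /=; lia.
      exact: leq_trans (leq_pred j) (ltnW jM).
    rewrite j0 b0 !mul0r normr0; exact: BU.
  (* For [j = M - 1] the index [j.+2] leaves the chain, and [beta M.+1 = 0] removes the term. *)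
  have e4 : `|beta j.+2 * s j ^+ 2 * (z j * z j.+2)| <= q * B * U.
    have [j2|j2] := leqP j.+2 M.
      by apply: cross; rewrite ?beta0 ?(ltnW jM) //; clear; lia.
    have -> : j.+2 = M.+1 by apply/eqP; rewrite eqn_leq !ltnS jM.
    by rewrite bM !mul0r normr0.
  have e5 : `|(kappa^-1 * (- (h j + h j.+1))) * s j ^+ 2 * (z j * z j.+1)| <= q * (2 * (H / k)) * U.
    have h1 := hh j (ltnW jM); have h2 := hh j.+1 jM.
    apply: cross; [exact: ltnW | exact: jM | by clear; lia |].
    have /andP[ki0 kl] := kinv.
    rewrite mulr_ge0 //=; last by lra.
    rewrite mulrC (_ : 2 * (H / k) = (2 * H) * k^-1); last by ring.
    apply: ler_pM => //; last by lra.
    by rewrite oppr_ge0; lra.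
  have e6 := young j.+1 j j jM (ltnW jM).
  have e7 := young j j.+1 j (ltnW jM) jM.
  move: e2 e3 e4 e5 e6 e7; rewrite !ler_norml; lra.
have zg : \sum_(j < M.+1) 2 * (z j * g j) <= theta * Z + theta^-1 * G.
  rewrite /Z /G /sumsq !mulr_sumr -big_split /=; apply: ler_sum => j _.
  have tn : theta != 0 by rewrite gt_eqF.
  have -> : g j = theta * (theta^-1 * g j) by field.
  have -> : theta^-1 * (theta * (theta^-1 * g j)) ^+ 2 = theta * (theta^-1 * g j) ^+ 2 by field.
  rewrite -subr_ge0; move: (theta^-1 * g j) => d.
  rewrite (_ : _ - _ = theta * (z j - d) ^+ 2); last by ring.
  by rewrite mulr_ge0 ?sqr_ge0 // ltW.
have tail : - (kappa^-1 * \sum_(j < M) T j) <=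
   - (\sum_(j < M) (s j * z j) ^+ 2) + M%:R * (q * (5 * B + 2 * (H / k))) * U
     + 2 * M%:R * (theta * Z + k^-1 ^+ 2 / theta * G).
  rewrite mulr_sumr -sumrN.
  apply: le_trans (ler_sum _ (fun (j : 'I_M) _ => Tle j (ltn_ord j))) _.
  under eq_bigr do rewrite -addrA.
  rewrite big_split sumrN sumr_const card_ord -mulr_natl -[leRHS]addrA lerD2l.
  by rewrite le_eqVlt; apply/orP; left; apply/eqP; ring.
have diss : \sum_(j < M.+1) 2 * (z j * chain_field R h beta kappa z j) <= - c * z M ^+ 2.
  rewrite -mulr_sumr sum_chain_field_mul b0 bM !mul0r subr0 mulr0 addr0.
  rewrite big_ord_recr /= mulrDr.
  have : \sum_(i < M) h i * z i ^+ 2 <= 0.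
    apply: sumr_le0 => -[i /= iM] _; have := hh i (ltnW iM); have := sqr_ge0 (z i); nra.
  by have := sqr_ge0 (z M); nra.
(* The last weight is 1, so the damping of [z M] is exactly a multiple of the last term of [U]. *)
have sM : s M = 1 by rewrite /s /chain_weight subnn.
have UE : U = \sum_(j < M) (s j * z j) ^+ 2 + z M ^+ 2.
  by rewrite /U /sumsq big_ord_recr /= sM mul1r.
have -> : chain_form_deriv R M (fun j => s j ^+ 2) kappa z
    (fun j => chain_field R h beta kappa z j + g j)
  = \sum_(j < M.+1) 2 * (z j * chain_field R h beta kappa z j)
   + \sum_(j < M.+1) 2 * (z j * g j) - kappa^-1 * \sum_(j < M) T j.
  rewrite /chain_form_deriv -big_split /=; congr (_ - _).
  by apply: eq_bigr => j _; ring.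
have : M%:R * (q * (5 * B + 2 * (H / k))) * U <= c / 2 * U by apply: ler_wpM2r.
have : 0 <= \sum_(j < M) (s j * z j) ^+ 2 by apply: sumr_ge0 => i _; apply: sqr_ge0.
have z2 := sqr_ge0 (z M).
move: UE diss zg tail z2.
move: (\sum_(j < M) (s j * z j) ^+ 2) => V.
move: (\sum_(j < M) T j) (\sum_(j < M.+1) 2 * (z j * g j)) => X Y.
move: (\sum_(j < M.+1) 2 * (z j * chain_field R h beta kappa z j)) => W.
move=> -> *.
(* The products dissipate [V] and the damping [c * z M ^+ 2]; since [c <= 1] these together dominate
   [c * U], half of which pays for the errors of size [q]. *)
have : 0 <= (1 - c) * V by apply: mulr_ge0; lra.
nra.
Qed.

Lemma exists_small (R : realFieldType) (a b x y : R) :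
  0 <= a -> 0 <= b -> 0 < x -> 0 < y ->
  exists q : R, [/\ 0 < q <= 1, a * q <= x & b * q <= y].
Proof.
move=> a0 b0 x0 y0; exists (1 + a / x + b / y)^-1.
have ax : 0 <= a / x by rewrite divr_ge0 // ltW.
have bx : 0 <= b / y by rewrite divr_ge0 // ltW.
have d0 : 0 < 1 + a / x + b / y by lra.
split.
- by rewrite invr_gt0 d0 invf_le1 //; lra.
- by rewrite ler_pdivrMr // mulrDr mulrDr mulrCA divff ?gt_eqF //; nra.
- by rewrite ler_pdivrMr // mulrDr [y * (b / y)]mulrCA divff ?gt_eqF //; nra.
Qed.

(** The weights, the rate and the constant are chosen before [kappa] and [beta]; this uniformity is
    what later gives one decay rate for all Fourier modes. *)
Lemma chain_hypocoercive (R : realFieldType) (M : nat) (h : nat -> R) (B k : R) :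
  0 < k -> 1 <= B -> (forall j, h j <= 0) -> h M < 0 ->
  exists delta : nat -> R, exists lam C : R, [/\ 0 < lam, 0 <= C &
  forall (kappa : R) (beta z g : nat -> R), k <= kappa ->
  beta 0%N = 0 -> beta M.+1 = 0 -> (forall j, (1 <= j <= M)%N -> 1 <= beta j <= B) ->
  [/\ sumsq R M.+1 z / 2 <= chain_form R M delta kappa z,
      chain_form R M delta kappa z <= 2 * sumsq R M.+1 z &
      chain_form_deriv R M delta kappa z (fun j => chain_field R h beta kappa z j + g j)
      <= - lam * chain_form R M delta kappa z + C * sumsq R M.+1 g]].
Proof.
move=> k0 B1 h0 hM.
pose H := \sum_(j < M.+1) - h j.
have hH j : (j <= M)%N -> - H <= h j <= 0.
  move=> jM; rewrite h0 andbT lerNl /H (bigD1 (Ordinal (jM : (j < M.+1)%N))) //= lerDl.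
  by apply: sumr_ge0 => i _; rewrite oppr_ge0.
have H0 : 0 <= H by apply: sumr_ge0 => i _; rewrite oppr_ge0.
pose c := Num.min 1 (- (2 * h M)).
have c0 : 0 < c by rewrite lt_min ltr01 /=; lra.
have c1 : c <= 1 by rewrite ge_min lexx.
have hc : 2 * h M <= - c by rewrite lerNr ge_min lexx orbT.
have Hk : 0 <= H / k by rewrite divr_ge0 // ltW.
have [//||||q [hq q1 q2]] := exists_small R (M%:R) (M%:R * (5 * B + 2 * (H / k))) (k / 2) (c / 2).
- by rewrite mulr_ge0 //; lra.
- by lra.
- by lra.
have /andP[q0 _] := hq.
(* The weight at 0 is the smallest one, so [s0 ^+ 2] converts the weighted dissipation into a
   multiple of the full sum of squares. *)
pose s0 := chain_weight R M q 0.
have s00 : 0 < s0 by exact: chain_weight_gt0.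
(* With this [theta] the Young terms consume c/4 times [s0 ^+ 2] of the available c/2. What remains,
   compared with a form bounded by twice the sum of squares, gives the rate c/8 times [s0 ^+ 2]. *)
pose theta := c / 4 * s0 ^+ 2 / (1 + 2 * M%:R).
have M0 : 0 <= M%:R :> R by [].
have m0 : 0 < 1 + 2 * M%:R :> R by lra.
have t0 : 0 < theta by rewrite divr_gt0 // mulr_gt0 ?exprn_gt0 //; lra.
exists (fun j => chain_weight R M q j ^+ 2), (c / 8 * s0 ^+ 2),
  (theta^-1 + 2 * M%:R * (k^-1 ^+ 2 / theta)); split.
- by rewrite mulr_gt0 ?exprn_gt0 //; lra.
- have ti : 0 <= theta^-1 by rewrite invr_ge0 ltW.
  apply: addr_ge0 => //; apply: mulr_ge0; apply: mulr_ge0 => //.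
  exact: sqr_ge0.
move=> kappa beta z g kk b0 bM hb.
have hk : 0 < k <= kappa by rewrite k0.
have /andP[Q1 Q2] := @chain_form_equiv R M q k kappa z hq hk q1.
split => //.
have hcc : 0 < c <= 1 by rewrite c0.
have q2' : M%:R * (q * (5 * B + 2 * (H / k))) <= c / 2
  by rewrite (_ : _ * _ = M%:R * (5 * B + 2 * (H / k)) * q) //; ring.
apply: le_trans (@chain_form_deriv_le R M h beta B H c q k kappa theta z g
  hq hk B1 t0 hH hcc hc q2' b0 bM hb) _.
rewrite lerD2r.
have -> : (1 + 2 * M%:R) * (theta * sumsq R M.+1 z) = c / 4 * (s0 ^+ 2 * sumsq R M.+1 z).
  by rewrite /theta; field; rewrite gt_eqF.
have : s0 ^+ 2 * sumsq R M.+1 z <= sumsq R M.+1 (fun j => chain_weight R M q j * z j).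
  rewrite /sumsq mulr_sumr; apply: ler_sum => j _; rewrite exprMn ler_wpM2r ?sqr_ge0 //.
  apply: lerXn2r; rewrite ?nnegrE ?(ltW s00) ?(ltW (chain_weight_gt0 _ _ _ _ _)) //.
  have /andP[q0' q1'] := hq; rewrite /s0 /chain_weight; apply: ler_wiXn2l => //; first exact: ltW.
  by rewrite leq_sub2l.
have -> : c / 8 * s0 ^+ 2 = c * s0 ^+ 2 / 8 by ring.
have s2 : 0 < c * s0 ^+ 2 by rewrite mulr_gt0 // exprn_gt0.
move: (sumsq _ _ (fun j => _ j * z j)) => U.
move: (sumsq R M.+1 z) Q2 => Z.
move: (chain_form _ _ _ _ _) => Q.
have -> : c / 4 * (s0 ^+ 2 * Z) = (c * s0 ^+ 2) / 4 * Z by ring.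
move=> QZ ZU.
have : c / 2 * (s0 ^+ 2 * Z) <= c / 2 * U by apply: ler_wpM2l => //; lra.
have -> : c / 2 * (s0 ^+ 2 * Z) = (c * s0 ^+ 2) / 2 * Z by ring.
have : (c * s0 ^+ 2) * Q <= (c * s0 ^+ 2) * (2 * Z) by apply: ler_wpM2l => //; exact: ltW.
lra.
Qed.

(** * Calculus of one-sided derivatives and a Gronwall estimate *)

Lemma is_deriv_within_cvg (R : realType) (S : set R) (f : R -> R) (t l : R) :
  is_deriv_within S f t l -> f s @[s --> within S t^'] --> f t.
Proof.
move=> df.
have fE : (fun s => f t + (s - t) * ((f s - f t) / (s - t))) = f.
  apply/funext => s; have [->|st] := eqVneq s t; first by rewrite subrr mul0r addr0.
  by field; rewrite subr_eq0.
have id0 : (s - t) @[s --> within S t^'] --> (0 : R).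
  rewrite -(subrr t); apply: cvgB; last exact: cvg_cst.
  by apply: cvg_within_filter; apply: cvg_within_filter; apply: cvg_id.
suff : f t + (s - t) * ((f s - f t) / (s - t)) @[s --> within S t^'] --> f t + 0 * l.
  by rewrite fE mul0r addr0.
by apply: cvgD; [exact: cvg_cst | exact: cvgM].
Qed.

Lemma is_deriv_within_ext (R : realType) (S : set R) (f g : R -> R) (t l : R) :
  f =1 g -> is_deriv_within S f t l -> is_deriv_within S g t l.
Proof. by move=> /funext ->. Qed.

Lemma is_deriv_withinC (R : realType) (S : set R) (c t : R) :
  is_deriv_within S (fun=> c) t 0.
Proof.
rewrite /is_deriv_within; under eq_fun do rewrite subrr mul0r.
exact: cvg_cst.
Qed.

Lemma is_deriv_withinD (R : realType) (S : set R) (f g : R -> R) (t a b : R) :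
  is_deriv_within S f t a -> is_deriv_within S g t b ->
  is_deriv_within S (fun s => f s + g s) t (a + b).
Proof.
move=> df dg; rewrite /is_deriv_within.
under eq_fun do rewrite opprD addrACA mulrDl.
exact: cvgD.
Qed.

Lemma is_deriv_withinZ (R : realType) (S : set R) (c : R) (f : R -> R) (t a : R) :
  is_deriv_within S f t a -> is_deriv_within S (fun s => c * f s) t (c * a).
Proof.
move=> df; rewrite /is_deriv_within.
under eq_fun do rewrite -mulrBr -mulrA.
exact: cvgZl_tmp.
Qed.

Lemma is_deriv_withinM (R : realType) (S : set R) (f g : R -> R) (t a b : R) :
  is_deriv_within S f t a -> is_deriv_within S g t b ->
  is_deriv_within S (fun s => f s * g s) t (a * g t + f t * b).
Proof.
move=> df dg; rewrite /is_deriv_within.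
have -> : (fun s => (f s * g s - f t * g t) / (s - t)) =
  (fun s => (f s - f t) / (s - t) * g t + f s * ((g s - g t) / (s - t))).
  by apply/funext => s; ring.
apply: cvgD; first exact: cvgZr_tmp.
by apply: cvgM => //; exact: is_deriv_within_cvg df.
Qed.

Lemma is_deriv_within_sum (R : realType) (S : set R) (n : nat)
    (f : nat -> R -> R) (t : R) (a : nat -> R) :
  (forall i, (i < n)%N -> is_deriv_within S (f i) t (a i)) ->
  is_deriv_within S (fun s => \sum_(i < n) f i s) t (\sum_(i < n) a i).
Proof.
elim: n => [|n IH] df.
  rewrite big_ord0; apply: is_deriv_within_ext (is_deriv_withinC _ _ 0 _) => s.
  by rewrite big_ord0.
rewrite big_ord_recr /=.
apply: is_deriv_within_ext (is_deriv_withinD _ _ _ _ _ _ _ (IH _) (df n _)) => //.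
- by move=> s; rewrite big_ord_recr.
- by move=> i ni; apply: df; apply: leqW.
Qed.

(** At [t > 0], increments smaller than [t] stay inside the half line, so the derivative within it
    is the ordinary one. *)
Lemma is_deriv_within_is_derive (R : realType) (f : R -> R) (t l : R) :
  0 < t -> is_deriv_within `[0, +oo[ f t l -> is_derive t 1 f l.
Proof.
move=> t0; rewrite /is_deriv_within => df.
suff H : h^-1 *: ((f \o shift t) (h *: 1) - f t) @[h --> 0^'] --> l.
  by apply: DeriveDef; [apply: cvgP H | apply: cvg_lim H].
apply/cvgrPdist_lt => e e0.
move/cvgrPdist_lt : df => /(_ e e0).
rewrite !near_withinE !near_simpl => -[d /= d0 dP].
exists (Num.min d t); first by rewrite /= lt_min d0.
move=> h /=; rewrite sub0r normrN lt_min => /andP[hd ht] h0.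
have := dP (h + t); rewrite /=.
rewrite opprD addrCA subrr addr0 normrN => /(_ hd).
rewrite -subr_eq0 addrK => /(_ h0).
rewrite /= in_itv /= andbT => H.
rewrite /GRing.scale /= mulr1 mulrC; apply: H.
by move: ht; rewrite ltr_norml; lra.
Qed.

Lemma is_deriv_within_continuous (R : realType) (f f' : R -> R) :
  (forall t, 0 <= t -> is_deriv_within `[0, +oo[ f t (f' t)) ->
  {within `[0, +oo[, continuous f}.
Proof.
move=> df; apply/subspace_continuousP => t /=; rewrite in_itv /= andbT => t0.
have /cvgrPdist_lt cf := is_deriv_within_cvg _ _ _ _ _ (df t t0).
apply/cvgrPdist_lt => e e0; have := cf e e0.
rewrite !near_withinE => -[d /= d0 dP]; exists d => //= s sd Ss.
have [->|st] := eqVneq s t; first by rewrite subrr normr0.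
exact: dP.
Qed.

(** The source decays like exp(-2 lam t), strictly faster than the homogeneous solution, so there is
    no resonance and no polynomial factor in [t]. *)
Lemma gronwall_decay (R : realType) (Q Q' : R -> R) (lam b : R) :
  0 < lam ->
  (forall t, 0 <= t -> is_deriv_within `[0, +oo[ Q t (Q' t)) ->
  (forall t, 0 <= t -> Q' t <= - lam * Q t + b * expR (- lam * t) ^+ 2) ->
  0 <= b ->
  forall t, 0 <= t -> Q t <= (Q 0 + b / lam) * expR (- lam * t).
Proof.
move=> l0 dQ Qle b0 t t0.
pose e (s : R) : R := expR (lam * s); pose e' (s : R) : R := expR (- lam * s).
(* The integrating factor [e] removes the linear term, and the second summand is an antiderivative
   of minus the transformed source [b * e']; hence [G] is nonincreasing. *)
pose G : R -> R := Q * e + (b / lam) \*: e'.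
have dexp (a s : R) : is_derive s (1 : R) (fun x : R => expR (a * x)) (a * expR (a * s)).
  have da : is_derive s (1 : R) (a \*: (@id R)) (a *: (1 : R)) by exact: is_deriveZ.
  have := @is_derive1_comp _ expR (a \*: (@id R)) s _ _ (is_derive_expR _) da.
  by rewrite /GRing.scale /= mulr1 mulrC.
have de (s : R) : is_derive s (1 : R) e (lam * e s) by exact: dexp.
have de' (s : R) : is_derive s (1 : R) e' (- lam * e' s) by exact: dexp.
have dG (s : R) : 0 < s -> is_derive s (1 : R) G (Q' s * e s + Q s * (lam * e s) - b * e' s).
  move=> s0; have dQs := is_deriv_within_is_derive _ _ _ _ s0 (dQ s (ltW s0)).
  apply: is_derive_eq; rewrite /GRing.scale /=; field; exact: lt0r_neq0.
have ee s : e s * e' s = 1.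
  by rewrite /e /e' -expRD -mulrDl addrN mul0r expR0.
have cG : {within `[0, +oo[, continuous G}.
  have cQ := is_deriv_within_continuous _ _ _ dQ.
  have ce : {within `[0, +oo[, continuous e}.
    apply: continuous_subspaceT => s.
    by apply/differentiable_continuous/derivable1_diffP; have [] := de s.
  have ce' : {within `[0, +oo[, continuous e'}.
    apply: continuous_subspaceT => s.
    by apply/differentiable_continuous/derivable1_diffP; have [] := de' s.
  move=> s; apply: cvgD; first by apply: cvgM; [exact: cQ | exact: ce].
  by apply: cvgZl_tmp; exact: ce'.
have := @ler0_derive1_nincry _ G 0 _ _ cG 0 t (lexx _) t0.
rewrite {1 2}/G /=.
have E0 : G 0 = Q 0 + b / lam.
  have G0 : G 0 = Q 0 * e 0 + b / lam * e' 0 by [].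
  by rewrite G0 /e /e' !mulr0 expR0 !mulr1.
have Et : G t = Q t * e t + b / lam * e' t by [].
move=> H.
have {}H : G t <= G 0.
  apply: H => s; rewrite in_itv /= andbT => s0; have := dG s s0.
    by case.
  move=> ds; rewrite derive1E derive_val.
  have := Qle s (ltW s0); rewrite -/(e' s) => Q1.
  have es : 0 < e s by exact: expR_gt0.
  have := ler_wpM2r (ltW es) Q1.
  have -> : (- lam * Q s + b * e' s ^+ 2) * e s =
    - lam * Q s * e s + b * e' s * (e s * e' s) by ring.
  by rewrite ee; lra.
have e't : 0 < e' t by exact: expR_gt0.
have : Q t * e t <= Q 0 + b / lam.
  rewrite -E0; apply: le_trans H; rewrite Et lerDl mulr_ge0 ?(ltW e't) //.
  by rewrite divr_ge0 // ltW.
move/(ler_wpM2r (ltW e't)).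
by rewrite -mulrA ee mulr1.
Qed.

Lemma is_deriv_within_chain_form (R : realType) (S : set R) (M : nat)
    (delta : nat -> R) (kappa t : R) (z : nat -> R -> R) (v : nat -> R) :
  (forall j, (j <= M)%N -> is_deriv_within S (z j) t (v j)) ->
  is_deriv_within S (fun s => chain_form R M delta kappa (fun j => z j s)) t
    (chain_form_deriv R M delta kappa (fun j => z j t) v).
Proof.
move=> dz; rewrite /chain_form_deriv -mulNr.
pose A j s := z j s * z j s; pose P j s := delta j * (z j s * z j.+1 s).
apply: is_deriv_within_ext (is_deriv_withinD _ _ _ _ _ _ _
  (is_deriv_within_sum _ _ M.+1 A _ (fun j => 2 * (z j t * v j)) _)
  (is_deriv_withinZ _ _ _ _ _ _ (is_deriv_within_sum _ _ M P _
    (fun j => delta j * (v j * z j.+1 t + z j t * v j.+1)) _))) => [s|j jM|j jM].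
- by rewrite /chain_form /sumsq -mulNr; congr (_ + _).
- rewrite (_ : 2 * _ = v j * z j t + z j t * v j); last by ring.
  by apply: is_deriv_withinM; exact: dz.
- by apply/is_deriv_withinZ/is_deriv_withinM; apply: dz => //; exact: ltnW.
Qed.

Lemma sumsq_le (R : realFieldType) (n : nat) (z : nat -> R) (a : R) :
  (forall j, (j < n)%N -> `|z j| <= a) -> sumsq R n z <= n%:R * a ^+ 2.
Proof.
move=> za; rewrite mulr_natl -[n in leRHS]card_ord -sumr_const.
apply: ler_sum => j _; rewrite -real_normK ?num_real //.
by apply: lerXn2r; rewrite ?nnegrE ?za // (le_trans _ (za j _)).
Qed.

(** The differential inequality for the Lyapunov form is integrated, and the equivalence with the
    sum of squares is used at time [t] and at time 0. *)
Lemma chain_decay (R : realType) (M : nat) (h : nat -> R) (B k : R) :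
  0 < k -> 1 <= B -> (forall j, h j <= 0) -> h M < 0 ->
  exists mu K : R, [/\ 0 < mu, 0 <= K &
  forall (kappa : R) (beta : nat -> R) (z g : nat -> R -> R) (a phi : R),
  k <= kappa -> beta 0%N = 0 -> beta M.+1 = 0 ->
  (forall j, (1 <= j <= M)%N -> 1 <= beta j <= B) ->
  (forall j t, (j <= M)%N -> 0 <= t -> is_deriv_within `[0, +oo[ (z j) t
     (chain_field R h beta kappa (fun i => z i t) j + g j t)) ->
  (forall j, (j <= M)%N -> `|z j 0| <= a) ->
  (forall j t, (j <= M)%N -> 0 <= t -> `|g j t| <= phi * expR (- mu * t) ^+ 2) ->
  forall j t, (j <= M)%N -> 0 <= t -> `|z j t| <= K * (a + phi) * expR (- mu * t)].
Proof.
move=> k0 B1 h0 hM.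
have [delta [lam [C [l0 C0 HQ]]]] := chain_hypocoercive R M h B k k0 B1 h0 hM.
(* The factors come from [z j t ^+ 2 <= 2 * Q t], [Q 0] at most twice the initial sum of squares,
   and the source integral in the Gronwall bound. *)
pose K0 : R := 4 * M.+1%:R + 2 * (C * M.+1%:R / lam).
have Kp : 0 <= C * M.+1%:R / lam by rewrite divr_ge0 ?mulr_ge0 // ltW.
have K00 : 0 <= K0 by rewrite addr_ge0 // mulr_ge0.
(* The form is quadratic, so the components decay at half its rate. The square of [1 + K0] is at
   least [K0], which avoids a square root in the constant. *)
exists (lam / 2), (1 + K0); split; [by rewrite divr_gt0|lra|].
move=> kappa beta z g a phi kk b0 bM hb dz z0 gphi j t jM t0.
have a0 : 0 <= a by apply: le_trans (z0 0%N isT).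
have phi0 : 0 <= phi.
  by have := gphi 0%N 0 isT (lexx _); rewrite mulr0 expR0 expr1n mulr1; apply: le_trans.
have e2 (s : R) : expR (- (lam / 2) * s) ^+ 2 = expR (- lam * s).
  by rewrite expr2 -expRD; congr expR; field.
pose Q s := chain_form R M delta kappa (fun j => z j s).
pose Q' s := chain_form_deriv R M delta kappa (fun j => z j s)
  (fun j => chain_field R h beta kappa (fun i => z i s) j + g j s).
have dQ s : 0 <= s -> is_deriv_within `[0, +oo[ Q s (Q' s).
  by move=> s0; apply: is_deriv_within_chain_form => i iM; exact: dz.
have QQ s := HQ kappa beta (fun i => z i s) (fun i => g i s) kk b0 bM hb.
have Q'le s : 0 <= s -> Q' s <= - lam * Q s + (C * (M.+1%:R * phi ^+ 2)) * expR (- lam * s) ^+ 2.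
  move=> s0; have [_ _ q] := QQ s; apply: le_trans q _; rewrite lerD2l.
  rewrite -[leRHS]mulrA; apply: ler_wpM2l => //; rewrite -mulrA -exprMn.
  by apply: sumsq_le => i iM; rewrite -e2; exact: gphi.
have b'0 : 0 <= C * (M.+1%:R * phi ^+ 2) by rewrite mulr_ge0 // mulr_ge0 ?sqr_ge0.
have := gronwall_decay _ _ _ _ _ l0 dQ Q'le b'0 t t0.
have [q1 _ _] := QQ t; have [_ q2 _] := QQ 0.
have zj : z j t ^+ 2 <= sumsq R M.+1 (fun i => z i t).
  exact: (@sqr_le_sum _ M.+1 (fun i => z i t)).
have S0 : sumsq R M.+1 (fun i => z i 0) <= M.+1%:R * a ^+ 2 by exact: sumsq_le.
move=> Qt.
have E0 : 0 < expR (- lam * t) by exact: expR_gt0.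
have zt : z j t ^+ 2 <= K0 * (a ^+ 2 + phi ^+ 2) * expR (- lam * t).
  have : Q t <= (2 * (M.+1%:R * a ^+ 2) + C * (M.+1%:R * phi ^+ 2) / lam) * expR (- lam * t).
    apply: le_trans Qt _; rewrite ler_pM2r // lerD2r.
    by apply: le_trans q2 _; rewrite ler_pM2l.
  have : z j t ^+ 2 <= 2 * Q t by rewrite -/(Q t) in q1; lra.
  move=> h1 h2; apply: le_trans h1 _.
  apply: (@le_trans _ _ (2 * ((2 * (M.+1%:R * a ^+ 2)
      + C * (M.+1%:R * phi ^+ 2) / lam) * expR (- lam * t)))).
    by rewrite ler_pM2l.
  rewrite mulrA ler_pM2r // /K0.
  have -> : C * (M.+1%:R * phi ^+ 2) / lam = C * M.+1%:R / lam * phi ^+ 2 by ring.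
  move: (C * M.+1%:R / lam) Kp => c c0.
  have := mulr_ge0 c0 (sqr_ge0 a).
  have := mulr_ge0 (ler0n R M.+1) (sqr_ge0 phi).
  lra.
rewrite -[leRHS]ger0_norm; last by rewrite !mulr_ge0 ?expR_ge0 //; lra.
rewrite -ler_sqr ?nnegrE // !real_normK ?num_real //.
apply: le_trans zt _; rewrite exprMn e2 ler_pM2r //.
have : 0 <= a * phi by exact: mulr_ge0.
have := sqr_ge0 a; have := sqr_ge0 phi => p1 p2 p3.
have : K0 <= (1 + K0) ^+ 2 by nra.
rewrite exprMn => KK; apply: ler_pM => //; first lra.
by rewrite sqrrD; lra.
Qed.

(** * Real and imaginary parts, and the complex modulus *)

Lemma ReD (R : realType) (x y : R[i]) : complex.Re (x + y) = complex.Re x + complex.Re y.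
Proof. by case: x; case: y. Qed.

Lemma ImD (R : realType) (x y : R[i]) : complex.Im (x + y) = complex.Im x + complex.Im y.
Proof. by case: x; case: y. Qed.

Lemma ReZ (R : realType) (a : R) (x : R[i]) : complex.Re (a%:C * x) = a * complex.Re x.
Proof. by case: x => u v /=; rewrite mul0r subr0. Qed.

Lemma ImZ (R : realType) (a : R) (x : R[i]) : complex.Im (a%:C * x) = a * complex.Im x.
Proof. by case: x => u v /=; rewrite mul0r addr0. Qed.

Lemma normr_Re_le (R : realType) (x : R[i]) : `|complex.Re x| <= Normc.normc x.
Proof.
case: x => u v /=; rewrite -(ger0_norm (sqrtr_ge0 _)) -ler_sqr ?nnegrE //.
rewrite !real_normK ?num_real // sqr_sqrtr ?addr_ge0 ?sqr_ge0 //.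
by rewrite lerDl sqr_ge0.
Qed.

Lemma normr_Im_le (R : realType) (x : R[i]) : `|complex.Im x| <= Normc.normc x.
Proof.
case: x => u v /=; rewrite -(ger0_norm (sqrtr_ge0 _)) -ler_sqr ?nnegrE //.
rewrite !real_normK ?num_real // sqr_sqrtr ?addr_ge0 ?sqr_ge0 //.
by rewrite lerDr sqr_ge0.
Qed.

Lemma normc_le_ReIm (R : realType) (x : R[i]) :
  Normc.normc x <= `|complex.Re x| + `|complex.Im x|.
Proof.
case: x => u v /=; rewrite -[leRHS]ger0_norm ?addr_ge0 //.
rewrite -[leLHS](ger0_norm (sqrtr_ge0 _)) -ler_sqr ?nnegrE //.
rewrite !real_normK ?num_real // sqr_sqrtr ?addr_ge0 ?sqr_ge0 //.
rewrite sqrrD !real_normK ?num_real //.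
by have := mulr_ge0 (normr_ge0 u) (normr_ge0 v); lra.
Qed.

Lemma normc_ge0 (R : realType) (x : R[i]) : 0 <= Normc.normc x.
Proof. by case: x => u v; apply: sqrtr_ge0. Qed.

Lemma normc_real (R : realType) (a : R) : Normc.normc a%:C = `|a|.
Proof. by rewrite /= expr0n addr0 sqrtr_sqr. Qed.

Lemma normc_imag (R : realType) (a : R) : Normc.normc (0 +i* a) = `|a|.
Proof. by rewrite /= expr0n add0r sqrtr_sqr. Qed.

Lemma normc_sum (R : realType) (I : Type) (r : seq I) (P : pred I) (F : I -> R[i]) :
  Normc.normc (\sum_(i <- r | P i) F i) <= \sum_(i <- r | P i) Normc.normc (F i).
Proof.
elim/big_ind2 : _ => //; first by rewrite Normc.normc0.
move=> x a y b xa yb; apply: le_trans (le_normcD _ _) _; exact: lerD.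
Qed.

Lemma is_vderiv_withinZ (R : realType) (n : nat) (S : set R)
    (f : R -> 'cV[R[i]]_n) (t : R) (l : 'cV[R[i]]_n) (c : R[i]) (i : 'I_n) :
  is_vderiv_within S f t l ->
  is_deriv_within S (fun s => complex.Re (c * f s i 0)) t (complex.Re (c * l i 0)) /\
  is_deriv_within S (fun s => complex.Im (c * f s i 0)) t (complex.Im (c * l i 0)).
Proof.
move=> /(_ i) [dR dI]; case: c => u v.
have mulE (z : R[i]) : (u +i* v) * z =
  (u * complex.Re z + - v * complex.Im z) +i* (u * complex.Im z + v * complex.Re z).
  by case: z => x y; rewrite mulNr.
rewrite !mulE /=; split.
  apply: is_deriv_within_ext (is_deriv_withinD _ _ _ _ _ _ _
    (is_deriv_withinZ _ _ u _ _ _ dR) (is_deriv_withinZ _ _ (- v) _ _ _ dI)) => s.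
  by rewrite mulE.
apply: is_deriv_within_ext (is_deriv_withinD _ _ _ _ _ _ _
  (is_deriv_withinZ _ _ u _ _ _ dI) (is_deriv_withinZ _ _ v _ _ _ dR)) => s.
by rewrite mulE.
Qed.

(** * Symmetrisation of the moment system into a real antisymmetric chain *)

(** Coordinates are indexed by natural numbers and extended by zero, so that the last component has
    a vanishing right neighbour. *)
Definition ncoord (R : realType) (M : nat) (v : 'cV[R[i]]_M.+1) (j : nat) : R[i] :=
  if (j <= M)%N then v (inord j) 0 else 0.

Lemma ncoord_ord (R : realType) (M : nat) (v : 'cV[R[i]]_M.+1) (j : 'I_M.+1) :
  ncoord R M v j = v j 0.
Proof. by rewrite /ncoord -ltnS ltn_ord inord_val. Qed.

Lemma sum_if_eq_ncoord (R : realType) (M : nat) (v : 'cV[R[i]]_M.+1) (a : nat) (x : R[i]) :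
  \sum_(i < M.+1) (if i == a :> nat then x else 0) * v i 0 = x * ncoord R M v a.
Proof.
have [aM|aM] := leqP a M; last first.
  rewrite /ncoord leqNgt aM mulr0 big1 // => i _.
  case: eqP => [ia|_]; last by rewrite mul0r.
  by have := ltn_ord i; rewrite ia ltnS leqNgt aM.
rewrite (bigD1 (inord a)) //= inordK // eqxx /ncoord aM big1 ?addr0 // => i ia.
case: eqP => [ia'|_]; last by rewrite mul0r.
by case/negP: ia; apply/eqP/val_inj; rewrite /= inordK.
Qed.

(** At [j = 0] the coefficient of the default neighbour [j.-1] is the square root of 0, so the
    formula is uniform in [j]. *)
Lemma mul_matAG (R : realType) (M : nat) (a : R) (v : 'cV[R[i]]_M.+1) (j : nat) :
  (j <= M)%N ->
  (cmx (matA M + a *: matG M) *m v) (inord j) 0 =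
  (Num.sqrt j%:R + (if j == 1%N then a else 0))%:C * ncoord R M v j.-1
  + (Num.sqrt j.+1%:R)%:C * ncoord R M v j.+1.
Proof.
move=> jM; rewrite -!sum_if_eq_ncoord -big_split /= mxE; apply: eq_bigr => i _.
rewrite -mulrDl; congr (_ * _); rewrite !mxE inordK ?ltnS //.
case: j jM => [|j] jM /=.
  rewrite sqrtr0 mulr0 !addr0.
  by case: (nat_of_ord i) => [|[|i']]; rewrite /= ?addr0 ?add0r.
rewrite !eqSS [j == i :> nat]eq_sym.
have [E|ij2] := eqVneq (nat_of_ord i) j.+2.
  have -> : (nat_of_ord i == j) = false by apply/eqP; lia.
  by rewrite E andbF mulr0 addr0 add0r.
have [E|ij] := eqVneq (nat_of_ord i) j.
  by rewrite E andbb addr0; case: eqP; rewrite ?mulr1 ?mulr0.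
have -> : (j == 0%N) && (nat_of_ord i == 0%N) = false.
  by apply/andP => -[/eqP j0 /eqP i0]; case/eqP: ij; rewrite i0 j0.
by rewrite mulr0 !addr0.
Qed.

Lemma mul_matB (R : realType) (M : nat) (v : 'cV[R[i]]_M.+1) (j : nat) :
  (j <= M)%N ->
  (cmx (matB M) *m v) (inord j) 0 = (Num.sqrt j%:R)%:C * ncoord R M v j.-1.
Proof.
move=> jM; rewrite -sum_if_eq_ncoord mxE; apply: eq_bigr => i _.
congr (_ * _); rewrite !mxE inordK ?ltnS //.
case: j jM => [|j] jM /=; first by rewrite sqrtr0; case: ifP.
by rewrite eqSS eq_sym; case: ifP.
Qed.

(* With r = 1 + 1/kappa^2, this conjugates - i kappa (A + G / kappa^2) to kappa
   times an antisymmetric real matrix, whose entries are given by [coupling]. *)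
Definition symm_factor (R : realType) (r : R) (j : nat) : R[i] :=
  (if j == 0%N then Num.sqrt r else 1)%:C * 'i ^+ j.

Definition coupling (R : realType) (M : nat) (r : R) (j : nat) : R :=
  if (1 <= j <= M)%N then (if j == 1%N then Num.sqrt r else Num.sqrt j%:R) else 0.

(** The delicate row is [j = 1], where the entry equals [r]: the factor [Num.sqrt r] in component 0
    absorbs one square root and leaves the other, the same value as in the transposed entry. *)
Lemma coupling_prev (R : realType) (M : nat) (r : R) (j : nat) :
  0 <= r -> (j <= M)%N ->
  symm_factor R r j * - 'i * (Num.sqrt j%:R + (if j == 1%N then r - 1 else 0))%:C
  = (coupling R M r j)%:C * symm_factor R r j.-1.
Proof.
move=> r0; rewrite /symm_factor /coupling; case: j => [|[|j]] jM /=.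
- by rewrite sqrtr0 addr0 rmorph0 mulr0 mul0r.
- rewrite jM sqrtr1 subrKC expr1 expr0 mul1r mulrN -expr2 sqr_i opprK mul1r mulr1.
  by rewrite -rmorphM -expr2 sqr_sqrtr.
- rewrite jM addr0 !mul1r exprS mulrN mulrAC -expr2 sqr_i mulN1r opprK.
  by rewrite mulrC.
Qed.

Lemma coupling_next (R : realType) (M : nat) (r : R) (j : nat) :
  (j < M)%N ->
  symm_factor R r j * 'i * (Num.sqrt j.+1%:R)%:C
  = (coupling R M r j.+1)%:C * symm_factor R r j.+1.
Proof.
move=> jM; rewrite /symm_factor /coupling ltnS jM /=; case: j jM => [|j] jM /=.
- by rewrite sqrtr1 expr0 !mulr1 mul1r.
- by rewrite !mul1r -exprSr mulrC.
Qed.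

(** After the change of variables all coefficients of the linear part are real, so real and
    imaginary parts will solve two separate copies of the same chain. *)
Lemma symm_system (R : realType) (M : nat) (h : 'rV[R]_M.+1) (kappa : R)
    (v df F : 'cV[R[i]]_M.+1) (j : nat) :
  (j <= M)%N ->
  df + (0 +i* kappa) *: (cmx (matA M + (kappa ^+ 2)^-1 *: matG M) *m v) + F
    = cmx (diag_mx h) *m v ->
  let r := 1 + (kappa ^+ 2)^-1 in
  let y i := symm_factor R r i * ncoord R M v i in
  symm_factor R r j * df (inord j) 0 =
  (h 0 (inord j))%:C * y j
  + kappa%:C * ((coupling R M r j)%:C * y j.-1 - (coupling R M r j.+1)%:C * y j.+1)
  + symm_factor R r j * - F (inord j) 0.
Proof.
move=> jM /matrixP /(_ (inord j) 0) E r y.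
have r0 : 0 <= r by rewrite addr_ge0 // invr_ge0 sqr_ge0.
move: E; rewrite [LHS]mxE [X in X + _]mxE [X in _ + X + _]mxE mul_matAG //.
have -> : (cmx (diag_mx h) *m v) (inord j) 0 = (h 0 (inord j))%:C * ncoord R M v j.
  rewrite /cmx map_diag_mx mul_diag_mx !mxE /ncoord jM //.
move=> E.
have {E}-> : df (inord j) 0 = (h 0 (inord j))%:C * ncoord R M v j
  - (0 +i* kappa) * ((Num.sqrt j%:R + (if j == 1%N then (kappa ^+ 2)^-1 else 0))%:C * ncoord R M v j.-1
      + (Num.sqrt j.+1%:R)%:C * ncoord R M v j.+1) - F (inord j) 0.
  by rewrite -E; ring.
have -> : (kappa ^+ 2)^-1 = r - 1 by rewrite /r addrC addKr.
have -> : 0 +i* kappa = kappa%:C * 'i by simpc.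
have P := coupling_prev R M r j r0 jM.
(* At [j = M] both sides vanish because [ncoord] is zero beyond the last index. *)
have N : symm_factor R r j * 'i * (Num.sqrt j.+1%:R)%:C * ncoord R M v j.+1
   = (coupling R M r j.+1)%:C * y j.+1.
  have [j1|j1] := ltnP j M; first by rewrite (coupling_next R M) // /y mulrA.
  by rewrite /y /ncoord ltnNge j1 /= !mulr0.
rewrite -N /y [(coupling R M r j)%:C * (_ * _)]mulrA -P; ring.
Qed.

Lemma sqrtr_le_id (R : realType) (x : R) : 1 <= x -> Num.sqrt x <= x.
Proof.
move=> x1; have x0 : 0 <= x by lra.
rewrite -[leRHS]ger0_norm // -sqrtr_sqr ler_wsqrtr // expr2 ler_peMr //.
Qed.

Lemma coupling_bound (R : realType) (M : nat) (r B : R) (j : nat) :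
  1 <= r <= B -> M%:R <= B -> (1 <= j <= M)%N -> 1 <= coupling R M r j <= B.
Proof.
move=> /andP[r1 rB] MB /andP[j1 jM]; rewrite /coupling j1 jM /=.
have s1 (x : R) : 1 <= x -> 1 <= Num.sqrt x by move=> x1; rewrite -sqrtr1 ler_wsqrtr.
case: eqP => _; first by rewrite s1 //= (le_trans (sqrtr_le_id _ _ r1)).
have j1' : 1 <= j%:R :> R by rewrite ler1n.
rewrite s1 //= (le_trans (sqrtr_le_id _ _ j1')) // (le_trans _ MB) //.
by rewrite ler_nat.
Qed.

Lemma normc_symm_factor (R : realType) (r : R) (j : nat) : 1 <= r ->
  1 <= Normc.normc (symm_factor R r j) <= r.
Proof.
move=> r1; rewrite /symm_factor Normc.normcM normc_real.
have -> : Normc.normc ('i ^+ j : R[i]) = 1.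
  elim: j => [|j IH]; first by rewrite expr0 Normc.normc1.
  by rewrite exprS Normc.normcM IH normc_imag normr1 mulr1.
rewrite mulr1; case: ifP => _; last by rewrite normr1 lexx.
rewrite ger0_norm ?sqrtr_ge0 // sqrtr_le_id // andbT -sqrtr1.
exact: ler_wsqrtr.
Qed.

Lemma linear_decay (R : realType) (M : nat) (k : R) (h : 'rV[R]_M.+1) :
  0 < k -> (forall i, h 0 i <= 0) -> h 0 ord_max != 0 ->
  exists mu K : R, [/\ 0 < mu, 0 <= K &
  forall (kappa : R) (f F : R -> 'cV[R[i]]_M.+1) (a phi : R), k <= kappa ->
  (forall t, 0 <= t -> exists2 df, is_vderiv_within `[0, +oo[ f t df &
     df + (0 +i* kappa) *: (cmx (matA M + (kappa ^+ 2)^-1 *: matG M) *m f t) + F t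
     = cmx (diag_mx h) *m f t) ->
  (forall i, Normc.normc (f 0 i 0) <= a) ->
  (forall i t, 0 <= t -> Normc.normc (F t i 0) <= phi * expR (- mu * t) ^+ 2) ->
  forall i t, 0 <= t -> Normc.normc (f t i 0) <= K * (a + phi) * expR (- mu * t)].
Proof.
move=> k0 h0 hM.
pose hn j := h 0 (inord j).
have hnM : hn M < 0.
  rewrite lt_neqAle h0 andbT (_ : hn M = h 0 ord_max) //.
  by congr (h 0 _); apply/val_inj; rewrite /= inordK.
(* One bound for all [kappa >= k], covering both the couplings and the moduli of the symmetrising
   factors. *)
pose B := 1 + (k ^+ 2)^-1 + M%:R.
have ki : 0 <= (k ^+ 2)^-1 by rewrite invr_ge0 sqr_ge0.
have B1 : 1 <= B by rewrite /B -addrA lerDl addr_ge0.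
have [mu [K [mu0 K0 HK]]] := chain_decay R M hn B k k0 B1 (fun j => h0 _) hnM.
(* The 2 comes from adding real and imaginary parts, and [B] from transforming initial data and
   source. Transforming back costs nothing, as the factors have modulus at least 1. *)
exists mu, (2 * K * B); split => //.
  by rewrite !mulr_ge0 // (le_trans _ B1).
move=> kappa f F a phi kk ode f0 Fphi i t t0.
pose r := 1 + (kappa ^+ 2)^-1.
have kap0 : 0 < kappa by apply: lt_le_trans kk.
have r1 : 1 <= r by rewrite lerDl invr_ge0 sqr_ge0.
have rB : r <= B.
  rewrite -[r]addr0; apply: lerD => //; rewrite lerD2l lef_pV2 ?posrE ?exprn_gt0 //.
  by apply: lerXn2r; rewrite ?nnegrE ?(ltW k0) ?(ltW kap0).
have MB : M%:R <= B by rewrite lerDr addr_ge0.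
pose beta := coupling R M r.
pose y j s := symm_factor R r j * ncoord R M (f s) j.
pose g j s := symm_factor R r j * - F s (inord j) 0.
have beta0 : beta 0%N = 0 by [].
have betaM : beta M.+1 = 0 by rewrite /beta /coupling ltnn.
have betaB j : (1 <= j <= M)%N -> 1 <= beta j <= B.
  by apply: coupling_bound; rewrite ?r1.
have sB j : Normc.normc (symm_factor R r j) <= B.
  by have /andP[_ sr] := normc_symm_factor R r j r1; apply: le_trans rB.
have y0 j : (j <= M)%N -> Normc.normc (y j 0) <= B * a.
  move=> jM; rewrite /y /ncoord jM Normc.normcM.
  by apply: ler_pM; rewrite ?normc_ge0.
have gB j s : (j <= M)%N -> 0 <= s -> Normc.normc (g j s) <= B * phi * expR (- mu * s) ^+ 2.
  move=> jM s0; rewrite /g Normc.normcM normcN -mulrA.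
  by apply: ler_pM; rewrite ?normc_ge0 // Fphi.
have yd j s : (j <= M)%N -> 0 <= s ->
  is_deriv_within `[0, +oo[ (fun s => complex.Re (y j s)) s
    (chain_field R hn beta kappa (fun i => complex.Re (y i s)) j + complex.Re (g j s)) /\
  is_deriv_within `[0, +oo[ (fun s => complex.Im (y j s)) s
    (chain_field R hn beta kappa (fun i => complex.Im (y i s)) j + complex.Im (g j s)).
  move=> jM s0; have [df dfP E] := ode s s0.
  have := is_vderiv_withinZ _ _ _ _ _ _ (symm_factor R r j) (inord j) dfP.
  have -> := symm_system _ _ _ _ _ _ _ _ jM E.
  rewrite -/r -/(g j s) -mulNr -rmorphN !(ReD, ImD, ReZ, ImZ) !mulNr.
  by rewrite /chain_field /y /ncoord jM.
have Hre := HK kappa beta (fun j s => complex.Re (y j s)) (fun j s => complex.Re (g j s))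
  (B * a) (B * phi) kk beta0 betaM betaB (fun j s jM s0 => (yd j s jM s0).1)
  (fun j jM => le_trans (normr_Re_le _ _) (y0 j jM))
  (fun j s jM s0 => le_trans (normr_Re_le _ _) (gB j s jM s0)) i t.
have Him := HK kappa beta (fun j s => complex.Im (y j s)) (fun j s => complex.Im (g j s))
  (B * a) (B * phi) kk beta0 betaM betaB (fun j s jM s0 => (yd j s jM s0).2)
  (fun j jM => le_trans (normr_Im_le _ _) (y0 j jM))
  (fun j s jM s0 => le_trans (normr_Im_le _ _) (gB j s jM s0)) i t.
have iM : (i <= M)%N by rewrite -ltnS.
have /andP[s1 _] := normc_symm_factor R r i r1.
apply: (@le_trans _ _ (Normc.normc (y i t))).
  by rewrite /y ncoord_ord Normc.normcM ler_peMl ?normc_ge0.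
apply: le_trans (normc_le_ReIm _ _) _.
apply: le_trans (lerD (Hre iM t0) (Him iM t0)) _.
by rewrite le_eqVlt; apply/orP; left; apply/eqP; ring.
Qed.

(** * Convolution estimate and induction over the Fourier modes *)

Lemma sum_inv_sqr_le (R : realFieldType) (n : nat) :
  \sum_(1 <= l < n.+2) (l%:R ^+ 2)^-1 <= 2 - n.+1%:R^-1 :> R.
Proof.
elim: n => [|n IH]; first by rewrite big_nat1 expr1n invr1; lra.
rewrite big_nat_recr //=; apply: le_trans (lerD IH (lexx _)) _.
have n0 : 0 < n.+1%:R :> R by rewrite ltr0n.
rewrite -[n.+2]addn1 natrD; move: (n.+1%:R) n0 => x x0.
rewrite -subr_ge0 (_ : _ - _ = (x * (x + 1) ^+ 2)^-1).
  by rewrite invr_ge0 mulr_ge0 ?sqr_ge0 // ltW.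
by field; apply/andP; split; apply: lt0r_neq0; lra.
Qed.

(** For m = a + b, 1/(ab) is (1/a + 1/b)/m, hence its square is at most 2(1/a^2 + 1/b^2)/m^2. Both
    resulting sums are at most 2, which gives the constant 8. *)
Lemma sum_inv_sqr_conv_le (R : realFieldType) (m : nat) :
  \sum_(1 <= l < m) (l%:R ^+ 2)^-1 * ((m - l)%:R ^+ 2)^-1 <= 8 * (m%:R ^+ 2)^-1 :> R.
Proof.
case: m => [|[|m]]; [by rewrite big_geq // mulr_ge0 // invr_ge0 sqr_ge0.. |].
set x : R := m.+2%:R; have x0 : 0 < x by rewrite ltr0n.
have S2 : \sum_(1 <= l < m.+2) (l%:R ^+ 2)^-1 <= 2 :> R.
  apply: le_trans (sum_inv_sqr_le _ _) _.
  by rewrite lerBlDr lerDl invr_ge0.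
apply: (@le_trans _ _ (\sum_(1 <= l < m.+2) 2 * (x ^+ 2)^-1 *
    ((l%:R ^+ 2)^-1 + ((m.+2 - l)%:R ^+ 2)^-1))).
  apply: ler_sum_nat => l /andP[l1 lm].
  have a0 : 0 < l%:R :> R by rewrite ltr0n.
  have b0 : 0 < (m.+2 - l)%:R :> R by rewrite ltr0n subn_gt0.
  have xab : x = l%:R + (m.+2 - l)%:R by rewrite -natrD subnKC // ltnW.
  move: (l%:R) ((m.+2 - l)%:R) a0 b0 xab => a b a0 b0 xab.
  rewrite -subr_ge0 (_ : _ - _ = (a - b) ^+ 2 * ((x * a * b) ^+ 2)^-1).
    by rewrite mulr_ge0 ?sqr_ge0 // invr_ge0 sqr_ge0.
  rewrite xab in x0 *; field.
  by rewrite !gt_eqF.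
rewrite -mulr_sumr big_split /= [X in _ + X]big_nat_rev /=.
have -> : \sum_(1 <= i < m.+2) ((m.+2 - (1 + m.+2 - i.+1))%:R ^+ 2)^-1 =
   \sum_(1 <= l < m.+2) (l%:R ^+ 2)^-1 :> R.
  apply: eq_big_nat => i /andP[i1 im].
  by have -> : (m.+2 - (1 + m.+2 - i.+1))%N = i by lia.
have xi : 0 <= (x ^+ 2)^-1 by rewrite invr_ge0 sqr_ge0.
rewrite (_ : 8 * _ = 2 * (x ^+ 2)^-1 * (2 + 2)); last by ring.
by apply: ler_wpM2l; [exact: mulr_ge0 | exact: lerD].
Qed.

Lemma normc_mul_matB_le (R : realType) (M : nat) (v : 'cV[R[i]]_M.+1) (b : R) (i : 'I_M.+1) :
  (forall j, Normc.normc (v j 0) <= b) ->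
  Normc.normc ((cmx (matB M) *m v) i 0) <= M%:R * b.
Proof.
move=> vb; have b0 : 0 <= b by apply: le_trans (vb ord0); apply: normc_ge0.
have iM : (i <= M)%N by rewrite -ltnS.
rewrite -{1}(inord_val i) mul_matB // Normc.normcM normc_real ger0_norm ?sqrtr_ge0 //.
apply: ler_pM; rewrite ?sqrtr_ge0 ?normc_ge0 //.
  have [->|i0] := posnP i; first by rewrite sqrtr0.
  apply: le_trans (sqrtr_le_id _ _ _) _; first by rewrite ler1n.
  by rewrite ler_nat.
by rewrite /ncoord; case: ifP; rewrite ?Normc.normc0.
Qed.

Lemma coefficient_decay (R : realType) (M : nat) (k : R) (hk : 0 < k)
  (h : 'rV[R]_M.+1) (h_le0 : forall i, h 0 i <= 0) (h_last : h 0 ord_max != 0)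
  (fhat : nat -> R -> 'cV[R[i]]_M.+1)
  (fhat1_init : fhat 1%N 0 = e0 M)
  (fhat1_ode : forall t : R, 0 <= t ->
     exists2 df, is_vderiv_within `[0, +oo[ (fhat 1%N) t df &
       df + (0 +i* k) *: (cmx (matA M + (k ^+ 2)^-1 *: matG M) *m fhat 1%N t)
       = cmx (diag_mx h) *m fhat 1%N t)
  (fhat_init : forall m : nat, (2 <= m)%N -> fhat m 0 = 0)
  (fhat_ode : forall m : nat, (2 <= m)%N -> forall t : R, 0 <= t ->
     exists2 df, is_vderiv_within `[0, +oo[ (fhat m) t df &
       df + (0 +i* (m%:R * k)) *:
              (cmx (matA M + ((m%:R * k) ^+ 2)^-1 *: matG M) *m fhat m t)
          + (0 +i* k^-1) *:
              (\sum_(1 <= l < m)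
                 ((l%:R^-1)%:C * fhat l t ord0 0) *:
                   (cmx (matB M) *m fhat (m - l)%N t))
       = cmx (diag_mx h) *m fhat m t) :
  exists mu gam rho : R, [/\ 0 < mu, 0 < gam, 0 < rho &
    forall m i t, (1 <= m)%N -> 0 <= t ->
      Normc.normc (fhat m t i 0) <= gam * rho ^+ m * expR (- mu * t)].
Proof.
have [mu [K [mu0 K0 HK]]] := linear_decay R M k h hk h_le0 h_last.
pose L := k^-1 * M%:R.
have L0 : 0 <= L by rewrite mulr_ge0 // invr_ge0 ltW.
have KL0 : 0 <= K * L by exact: mulr_ge0.
(* This [gam] makes [8 * (K * L) * gam] at most 1, so the quadratic source reproduces the induction
   bound without loss. *)
pose gam := (8 * (K * L) + 1)^-1.
have gam0 : 0 < gam by rewrite invr_gt0; lra.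
have gKL : 8 * (K * L) * gam <= 1 by rewrite ler_pdivrMr; lra.
(* Then [gam * rho] is [K + gam], which covers the first mode. *)
pose rho := K / gam + 1.
have rho0 : 0 < rho by rewrite ltr_wpDl // divr_ge0 // ltW.
pose b m : R := gam * rho ^+ m * (m%:R ^+ 2)^-1.
have b0 m : 0 <= b m.
  by rewrite /b !mulr_ge0 ?(ltW gam0) ?exprn_ge0 ?(ltW rho0) ?invr_ge0 ?sqr_ge0.
exists mu, gam, rho; split => // m i t m1 t0.
(* The induction needs the stronger bound with the factor 1/m^2; that factor is dropped only
   here. *)
suff H : forall n i t, (1 <= n)%N -> 0 <= t -> Normc.normc (fhat n t i 0) <= b n * expR (- mu * t).
  apply: le_trans (H m i t m1 t0) _; rewrite ler_wpM2r ?expR_ge0 //.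
  rewrite /b ler_piMr //; first by rewrite mulr_ge0 ?exprn_ge0 // ltW.
  by rewrite invf_le1 ?exprn_gt0 ?ltr0n // exprn_ege1 // ler1n.
clear m i t m1 t0.
elim/ltn_ind => n IH i t n1 t0.
case: n n1 IH => [//|[|n]] _ IH.
  have ode (s : R) : 0 <= s -> exists2 df, is_vderiv_within `[0, +oo[ (fhat 1%N) s df &
       df + (0 +i* k) *: (cmx (matA M + (k ^+ 2)^-1 *: matG M) *m fhat 1%N s) + 0
       = cmx (diag_mx h) *m fhat 1%N s.
    by move=> s0; have [df dP E] := fhat1_ode s s0; exists df; rewrite ?addr0.
  have := HK k (fhat 1%N) (fun=> 0) 1 0 (lexx k) ode _ _ i t t0.
  rewrite addr0 mulr1 => H; apply: le_trans (H _ _) _.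
  - move=> j; rewrite fhat1_init mxE.
    by case: (_ && _); rewrite ?mulr1n ?mulr0n ?Normc.normc1 ?Normc.normc0.
  - by move=> j s s0; rewrite mxE Normc.normc0 mul0r.
  rewrite ler_wpM2r ?expR_ge0 // /b expr1 expr1n invr1 mulr1 /rho mulrDr mulr1.
  by rewrite mulrCA divff ?gt_eqF // mulr1 lerDl ltW.
move: n.+2 (isT : (1 < n.+2)%N) IH => {n} m m2 IH.
have km : k <= m%:R * k by rewrite ler_peMl ?ler1n ?(ltW hk) // ltnW.
(* [phi] bounds the amplitude of the quadratic source, by the induction hypothesis on both
   factors. *)
pose phi := L * \sum_(1 <= l < m) b l * b (m - l)%N.
have phib : K * phi <= b m.
  have -> : phi = L * gam ^+ 2 * rho ^+ m *
      \sum_(1 <= l < m) (l%:R ^+ 2)^-1 * ((m - l)%:R ^+ 2)^-1.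
    rewrite /phi !mulr_sumr.
    apply: eq_big_nat => l /andP[l1 lm]; rewrite /b.
    have -> : rho ^+ m = rho ^+ l * rho ^+ (m - l) by rewrite -exprD subnKC // ltnW.
    by ring.
  have c0 : 0 <= K * (L * gam ^+ 2 * rho ^+ m).
    apply: mulr_ge0 => //; apply: mulr_ge0; last exact/exprn_ge0/ltW.
    by apply: mulr_ge0 => //; exact: sqr_ge0.
  rewrite mulrA; apply: le_trans (ler_wpM2l c0 (sum_inv_sqr_conv_le _ _)) _.
  rewrite [leLHS](_ : _ = 8 * (K * L) * gam * b m); last by rewrite /b; ring.
  by rewrite ler_piMl.
have := HK (m%:R * k) (fhat m) _ 0 phi km (fhat_ode m m2) _ _ i t t0.
rewrite add0r => H; apply: le_trans (H _ _) _.
- by move=> j; rewrite fhat_init // mxE Normc.normc0.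
- move=> j s s0; rewrite mxE Normc.normcM normc_imag ger0_norm; last by rewrite invr_ge0 ltW.
  rewrite /phi /L -!mulrA ler_wpM2l ?invr_ge0 ?(ltW hk) //.
  rewrite summxE; apply: le_trans (normc_sum _ _ _ _ _) _.
  rewrite mulr_suml mulr_sumr; apply: ler_sum_nat => l /andP[l1 lm].
  have ml : (m - l < m)%N by rewrite ltn_subrL l1 ltnW.
  have ml1 : (1 <= m - l)%N by rewrite subn_gt0.
  rewrite mxE Normc.normcM Normc.normcM normc_real.
  (* Each factor of the product carries its own exponential; together they give the squared
     exponential that the linear estimate requires. The bound on 1/l is 1. *)
  rewrite (_ : M%:R * _ = (1 * (b l * expR (- mu * s))) *
    (M%:R * (b (m - l)%N * expR (- mu * s)))); last by ring.
  apply: ler_pM; rewrite ?mulr_ge0 ?normc_ge0 //.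
    apply: ler_pM; rewrite ?normc_ge0 ?IH //.
    by rewrite ger0_norm ?invr_ge0 // invf_le1 ?ltr0n // ler1n.
  by apply: normc_mul_matB_le => j'; apply: IH.
by rewrite ler_wpM2r ?expR_ge0.
Qed.

(** * Geometrically dominated series *)

(** Keeping the negative term makes the induction close, since 2^-n equals 2(2^-n - 2^-(n+1)). The
    term of index 0 is left unbounded, hence [1 <= N]. *)
Lemma sum_geometric_tail (R : realType) (a : nat -> R) (c : R) (N n : nat) :
  (forall m, (1 <= m)%N -> `|a m| <= c * 2^-1 ^+ m) -> (1 <= N <= n)%N ->
  `|\sum_(m < n) a m - \sum_(m < N) a m| <= 2 * c * (2^-1 ^+ N - 2^-1 ^+ n).
Proof.
move=> ac /andP[N1 Nn]; elim: n Nn => [|n IH] Nn.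
  by move: N1; rewrite (eqP (_ : N == 0%N)) // -leqn0.
move: Nn; rewrite leq_eqVlt => /orP[/eqP <-|]; first by rewrite !subrr normr0 mulr0.
rewrite ltnS => Nn; rewrite big_ord_recr /= addrAC.
apply: le_trans (ler_normD _ _) _.
apply: le_trans (lerD (IH Nn) (ac n (leq_trans N1 Nn))) _.
by rewrite exprS; move: (2^-1 ^+ n) (2^-1 ^+ N) => x y; lra.
Qed.

Lemma sum_geometric_cvg (R : realType) (a : nat -> R) (c : R) :
  (forall m, (1 <= m)%N -> `|a m| <= c * 2^-1 ^+ m) ->
  cvgn (fun n => \sum_(m < n) a m).
Proof.
move=> ac.
have -> : (fun n => \sum_(m < n) a m) = series a.
  by apply/funext => n; rewrite /series /= big_mkord.
apply: normed_cvg.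
have c0 : 0 <= c.
  by have := le_trans (normr_ge0 _) (ac 1%N isT); rewrite pmulr_lge0.
(* The constant is enlarged by the modulus of [a 0] so that the comparison also holds at index 0. *)
apply: (@series_le_cvg _ _ (geometric (c + `|a 0%N|) 2^-1)) => [n|n|n|] /=.
- by [].
- by rewrite mulr_ge0 ?addr_ge0 ?exprn_ge0.
- case: n => [|n]; first by rewrite expr0 mulr1 lerDr.
  apply: le_trans (ac n.+1 isT) _; rewrite ler_wpM2r ?exprn_ge0 //.
  by rewrite lerDl.
- apply: is_cvg_geometric_series; rewrite ger0_norm //; lra.
Qed.

Lemma sum_geometric_lim (R : realType) (a : nat -> R) (c : R) (N : nat) :
  (forall m, (1 <= m)%N -> `|a m| <= c * 2^-1 ^+ m) -> (1 <= N)%N ->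
  `|limn (fun n => \sum_(m < n) a m) - \sum_(m < N) a m| <= 2 * c * 2^-1 ^+ N.
Proof.
move=> ac N1; set s := fun n => \sum_(m < n) a m.
have cs : s n @[n --> \oo] --> limn s by apply: (sum_geometric_cvg _ _ c).
have c0 : 0 <= c.
  by have := le_trans (normr_ge0 _) (ac 1%N isT); rewrite pmulr_lge0.
have H : `|s n - \sum_(m < N) a m| @[n --> \oo] --> `|limn s - \sum_(m < N) a m|.
  by apply: cvg_norm; apply: cvgB => //; exact: cvg_cst.
rewrite -(cvg_lim _ H) //; apply: limr_le; first exact: cvgP H.
near=> n; have Nn : (1 <= N <= n)%N by rewrite N1; near: n; exact: nbhs_infty_ge.
apply: le_trans (sum_geometric_tail _ _ _ _ _ ac Nn) _.
apply: ler_wpM2l; first by rewrite mulr_ge0.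
by rewrite lerBlDr lerDl exprn_ge0.
Unshelve. all: by end_near. Qed.

(** * Measurability and convergence of the Fourier series in L2 *)

Definition coord_measurable (R : realType) (n : nat) (g : R -> 'cV[R[i]]_n) : Prop :=
  forall i, measurable_fun [set: R] (fun x => complex.Re (g x i 0)) /\
            measurable_fun [set: R] (fun x => complex.Im (g x i 0)).

Lemma coord_measurableB (R : realType) (n : nat) (f g : R -> 'cV[R[i]]_n) :
  coord_measurable R n f -> coord_measurable R n g ->
  coord_measurable R n (fun x => f x - g x).
Proof.
move=> mf mg i; have [fR fI] := mf i; have [gR gI] := mg i.
have E x : (f x - g x) i 0 = f x i 0 - g x i 0 by rewrite !mxE.
split.
- apply: eq_measurable_fun (measurable_funB fR gR) => x _ /=; rewrite E.
  by case: (f x i 0) (g x i 0) => u v [u' v'].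
- apply: eq_measurable_fun (measurable_funB fI gI) => x _ /=; rewrite E.
  by case: (f x i 0) (g x i 0) => u v [u' v'].
Qed.

(** The restricted Lebesgue measure has total mass [D], so a pointwise bound [b] integrates to at
    most the square root of b^2 D. *)
Lemma L2norm_le (R : realType) (n : nat) (D b : R) (g : R -> 'cV[R[i]]_n) :
  0 < D -> 0 <= b -> coord_measurable R n g -> (forall x, enorm (g x) <= b) ->
  (L2norm D g <= (b * Num.sqrt D)%:E)%E.
Proof.
move=> D0 b0 mg gb; rewrite /L2norm unlock.
set mu := mrestr _ _.
have muT : mu setT = D%:E.
  by rewrite /mu /mrestr /= setTI lebesgue_measure_itv /= lte_fin D0 oppr0 adde0.
have S0 x : 0 <= \sum_i (complex.Re (g x i 0) ^+ 2 + complex.Im (g x i 0) ^+ 2).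
  by rewrite sumr_ge0 // => i _; rewrite addr_ge0 ?sqr_ge0.
have sq x : (`|(enorm (g x))%:E| `^ 2)%E =
   (\sum_i (complex.Re (g x i 0) ^+ 2 + complex.Im (g x i 0) ^+ 2))%:E.
  rewrite abse_EFin poweR_EFin ger0_norm ?sqrtr_ge0 // powR_mulrn ?sqrtr_ge0 //.
  by rewrite sqr_sqrtr.
have I : (\int[mu]_x `|(enorm (g x))%:E| `^ 2 <= (b ^+ 2 * D)%:E)%E.
  apply: (@le_trans _ _ (\int[mu]_x (cst (b ^+ 2)%:E x))%E); last first.
    by rewrite integral_cst // (EFinM _ D) -muT; exact: lexx.
  apply: ge0_le_integral => //.
  - by move=> x _; apply: poweR_ge0.
  - under eq_fun do rewrite sq.
    apply/measurable_EFinP; apply: measurable_sum => i.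
    by have [mR mI] := mg i; apply: measurable_funD; apply: measurable_funX.
  - move=> x _; rewrite sq lee_fin -[leLHS]sqr_sqrtr ?S0 //.
    by apply: lerXn2r; rewrite ?nnegrE ?sqrtr_ge0 //; exact: gb.
have -> : (b * Num.sqrt D)%:E = ((b ^+ 2 * D)%:E `^ 2^-1)%E.
  rewrite poweR_EFin powR12_sqrt ?mulr_ge0 ?sqr_ge0 ?(ltW D0) //.
  by rewrite sqrtrM ?sqr_ge0 // sqrtr_sqr ger0_norm.
apply: gt0_ler_poweR => //; rewrite ?in_itv /= ?andbT ?leey //.
- by rewrite andbT; apply: integral_ge0 => x _; rewrite lee_fin powR_ge0.
- by rewrite andbT lee_fin mulr_ge0 ?sqr_ge0 ?(ltW D0).
Qed.

Lemma enorm_le (R : realType) (n : nat) (v : 'cV[R[i]]_n) (b : R) :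
  0 <= b -> (forall i, `|complex.Re (v i 0)| <= b /\ `|complex.Im (v i 0)| <= b) ->
  enorm v <= 2 * n%:R * b.
Proof.
move=> b0 vb; have [n0|n0] := posnP n.
  by subst n; rewrite /enorm big_ord0 sqrtr0 mulr0 mul0r.
rewrite -[leRHS]ger0_norm; last by rewrite !mulr_ge0.
rewrite -sqrtr_sqr ler_wsqrtr //.
apply: (@le_trans _ _ (\sum_(i < n) 2 * b ^+ 2)).
  apply: ler_sum => i _; have [vR vI] := vb i.
  have sq (x : R) : `|x| <= b -> x ^+ 2 <= b ^+ 2.
    by move=> xb; rewrite -real_normK ?num_real //; apply: lerXn2r; rewrite ?nnegrE.
  by have := sq _ vR; have := sq _ vI; lra.
rewrite sumr_const card_ord -mulr_natl.
have n1 : 1 <= n%:R :> R by rewrite ler1n.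
have b2 := sqr_ge0 b.
have : n%:R * b ^+ 2 <= n%:R * (n%:R * b ^+ 2) by rewrite ler_wpM2l // ler_peMl.
have : 0 <= n%:R * (n%:R * b ^+ 2) by rewrite !mulr_ge0.
by rewrite !exprMn; lra.
Qed.

Definition fourier_coord (R : realType) (n : nat) (k eps : R)
    (c : nat -> 'cV[R[i]]_n) (x : R) (i : 'I_n) (m : nat) : R[i] :=
  (eps ^+ m)%:C * cexpi (m%:R * k * x) * c m i 0.

Lemma Re_sum (R : realType) (N : nat) (F : nat -> R[i]) :
  complex.Re (\sum_(m < N) F m) = \sum_(m < N) complex.Re (F m).
Proof. by elim: N => [|N IH]; rewrite ?big_ord0 // !big_ord_recr ReD IH. Qed.

Lemma Im_sum (R : realType) (N : nat) (F : nat -> R[i]) :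
  complex.Im (\sum_(m < N) F m) = \sum_(m < N) complex.Im (F m).
Proof. by elim: N => [|N IH]; rewrite ?big_ord0 // !big_ord_recr ImD IH. Qed.

Lemma fourier_sumE (R : realType) (n : nat) (k eps : R) (c : nat -> 'cV[R[i]]_n)
    (N : nat) (x : R) (i : 'I_n) :
  fourier_sum k eps c N x i 0 = \sum_(m < N) fourier_coord R n k eps c x i m.
Proof. by rewrite /fourier_sum summxE; apply: eq_bigr => m _; rewrite mxE. Qed.

Lemma normc_fourier_coord (R : realType) (n : nat) (k eps : R)
    (c : nat -> 'cV[R[i]]_n) (x : R) (i : 'I_n) (m : nat) : 0 <= eps ->
  Normc.normc (fourier_coord R n k eps c x i m) = eps ^+ m * Normc.normc (c m i 0).
Proof.
move=> e0; rewrite /fourier_coord !Normc.normcM normc_real ger0_norm ?exprn_ge0 //.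
by rewrite /cexpi /Normc.normc cos2Dsin2 sqrtr1 mulr1.
Qed.

Lemma measurable_fourier_sum (R : realType) (n : nat) (k eps : R)
    (c : nat -> 'cV[R[i]]_n) (N : nat) :
  coord_measurable R n (fourier_sum k eps c N).
Proof.
move=> i.
have cs (m : nat) : continuous (fun x : R => cos (m%:R * k * x)).
  move=> x; apply: (@continuous_comp _ _ _ (fun x : R => m%:R * k * x) cos).
    exact: mulrl_continuous.
  exact: continuous_cos.
have sn (m : nat) : continuous (fun x : R => sin (m%:R * k * x)).
  move=> x; apply: (@continuous_comp _ _ _ (fun x : R => m%:R * k * x) sin).
    exact: mulrl_continuous.
  exact: continuous_sin.
have mc (m : nat) := continuous_measurable_fun (cs m).
have ms (m : nat) := continuous_measurable_fun (sn m).
have E m x : fourier_coord R n k eps c x i m =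
  (eps ^+ m * complex.Re (c m i 0) * cos (m%:R * k * x)
   - eps ^+ m * complex.Im (c m i 0) * sin (m%:R * k * x)) +i*
  (eps ^+ m * complex.Im (c m i 0) * cos (m%:R * k * x)
   + eps ^+ m * complex.Re (c m i 0) * sin (m%:R * k * x)).
  rewrite /fourier_coord /cexpi; case: (c m i 0) => u v.
  by congr (_ +i* _); rewrite /= !mul0r !subr0 !addr0; ring.
split.
- apply: (@eq_measurable_fun _ _ _ _ _ (fun x => \sum_(m < N)
    complex.Re (fourier_coord R n k eps c x i m))).
    by move=> x _; rewrite fourier_sumE Re_sum.
  apply: measurable_sum => m; under eq_fun do rewrite E /=.
  by apply: measurable_funB; apply: measurable_funM.
- apply: (@eq_measurable_fun _ _ _ _ _ (fun x => \sum_(m < N)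
    complex.Im (fourier_coord R n k eps c x i m))).
    by move=> x _; rewrite fourier_sumE Im_sum.
  apply: measurable_sum => m; under eq_fun do rewrite E /=.
  by apply: measurable_funD; apply: measurable_funM.
Qed.

(** The pointwise sum of the series; measurability passes to it from the partial sums, and it serves
    as the L2 limit. *)
Definition fourier_lim (R : realType) (n : nat) (k eps : R)
    (c : nat -> 'cV[R[i]]_n) (x : R) : 'cV[R[i]]_n :=
  \col_i (limn (fun N => \sum_(m < N) complex.Re (fourier_coord R n k eps c x i m)) +i*
          limn (fun N => \sum_(m < N) complex.Im (fourier_coord R n k eps c x i m))).

(** The exponentials have modulus 1, so the domination is uniform in [x] and pointwise tail
    estimates turn into L2 estimates. *)
Lemma fourier_series_L2 (R : realType) (n : nat) (D k eps b : R)
    (c : nat -> 'cV[R[i]]_n) :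
  0 < D -> 0 <= eps -> 0 <= b ->
  (forall m i, (1 <= m)%N -> eps ^+ m * Normc.normc (c m i 0) <= b * 2^-1 ^+ m) ->
  [/\ inL2 D (fourier_lim R n k eps c),
      L2cvg D (fourier_sum k eps c) (fourier_lim R n k eps c) &
      (L2norm D (fun x => fourier_lim R n k eps c x - c 0%N)%R
        <= (2 * n%:R * b * Num.sqrt D)%:E)%E].
Proof.
move=> D0 e0 b0 cb; set F := fourier_lim R n k eps c.
have aR x i m : (1 <= m)%N -> `|complex.Re (fourier_coord R n k eps c x i m)| <= b * 2^-1 ^+ m.
  by move=> m1; apply: le_trans (normr_Re_le _ _) _; rewrite normc_fourier_coord ?cb.
have aI x i m : (1 <= m)%N -> `|complex.Im (fourier_coord R n k eps c x i m)| <= b * 2^-1 ^+ m.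
  by move=> m1; apply: le_trans (normr_Im_le _ _) _; rewrite normc_fourier_coord ?cb.
have mF : coord_measurable R n F.
  move=> i; split.
  - apply: (@measurable_fun_cvg _ _ _ _ (fun N x => complex.Re (fourier_sum k eps c N x i 0))).
      by move=> N; have [] := measurable_fourier_sum R n k eps c N i.
    move=> x _; rewrite /F mxE /=; under eq_fun do rewrite fourier_sumE Re_sum.
    exact: (sum_geometric_cvg _ _ _ (aR x i)).
  - apply: (@measurable_fun_cvg _ _ _ _ (fun N x => complex.Im (fourier_sum k eps c N x i 0))).
      by move=> N; have [] := measurable_fourier_sum R n k eps c N i.
    move=> x _; rewrite /F mxE /=; under eq_fun do rewrite fourier_sumE Im_sum.
    exact: (sum_geometric_cvg _ _ _ (aI x i)).
have tail N x : (1 <= N)%N ->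
    enorm (F x - fourier_sum k eps c N x) <= 2 * n%:R * (2 * b * 2^-1 ^+ N).
  move=> N1; apply: enorm_le; first by rewrite !mulr_ge0 ?exprn_ge0.
  move=> i; rewrite mxE [X in _ + X]mxE fourier_sumE [F x i 0]mxE.
  have subE (u v : R) (w : R[i]) : u +i* v - w = (u - complex.Re w) +i* (v - complex.Im w).
    by case: w.
  by rewrite subE /= Re_sum Im_sum; split; [exact: (sum_geometric_lim _ _ _ _ (aR x i))
    | exact: (sum_geometric_lim _ _ _ _ (aI x i))].
have norm_tail N : (1 <= N)%N ->
   (L2norm D (fun x => fourier_sum k eps c N x - F x)%R
     <= (2 * n%:R * (2 * b * 2^-1 ^+ N) * Num.sqrt D)%:E)%E.
  move=> N1; apply: L2norm_le => //; first by rewrite !mulr_ge0 ?exprn_ge0.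
    by apply: coord_measurableB => //; exact: measurable_fourier_sum.
  move=> x; apply: le_trans (tail N x N1).
  rewrite le_eqVlt; apply/orP; left; apply/eqP; congr Num.sqrt.
  apply: eq_bigr => i _; rewrite !mxE.
  by case: (F x i 0) (fourier_sum k eps c N x i 0) => u v [u' v'] /=; ring.
(* The partial sum of length 1 is the mean, so the tail bound at [N = 1] is already the bound on the
   deviation from it. *)
have f1 x : fourier_sum k eps c 1 x = c 0%N.
  apply/matrixP => i j; rewrite ord1 fourier_sumE big_ord1 /fourier_coord.
  by rewrite expr0 !mul0r /cexpi cos0 sin0 !mul1r.
have L2F : (L2norm D (fun x => F x - c 0%N)%R <= (2 * n%:R * b * Num.sqrt D)%:E)%E.
  apply: L2norm_le => //; first by rewrite !mulr_ge0.
    have := coord_measurableB _ _ _ _ mF (measurable_fourier_sum R n k eps c 1).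
    by under eq_fun do rewrite f1.
  move=> x; have := tail 1%N x isT; rewrite f1 expr1.
  by rewrite (_ : 2 * b * 2^-1 = b) //; field.
split => //.
- split.
    move=> i; have [mR mI] := mF i.
    by split; apply: measurable_funS; [| |exact: mR| | |exact: mI].
  (* Square integrability of the full sum also involves the mean, whose size is added to the
     deviation bound [b]. *)
  pose B : R := \sum_i Normc.normc (c 0%N i 0) + b.
  have B0 : 0 <= B by rewrite addr_ge0 // sumr_ge0 // => i _; exact: normc_ge0.
  have FB x : enorm (F x) <= 2 * n%:R * B.
    apply: enorm_le => // i.
    have h1 : Normc.normc (c 0%N i 0) <= \sum_i Normc.normc (c 0%N i 0).
      by rewrite (bigD1 i) //= lerDl sumr_ge0 // => j _; exact: normc_ge0.
    have Fi : F x i 0 = (F x i 0 - c 0%N i 0) + c 0%N i 0 by rewrite subrK.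
    have := sum_geometric_lim _ _ _ 1 (aR x i) isT.
    have := sum_geometric_lim _ _ _ 1 (aI x i) isT.
    rewrite !big_ord1 /F mxE /= expr1 => HI HR.
    have f0 : fourier_coord R n k eps c x i 0 = c 0%N i 0.
      by have := fourier_sumE R n k eps c 1 x i; rewrite f1 big_ord1 => ->.
    move: HI HR; rewrite f0 (_ : 2 * b * 2^-1 = b); last by field.
    have := normr_Re_le _ (c 0%N i 0); have := normr_Im_le _ (c 0%N i 0).
    rewrite /B !ler_norml => /andP[? ?] /andP[? ?] /andP[? ?] /andP[? ?].
    by split; apply/andP; split; lra.
  apply: le_lt_trans (L2norm_le _ _ _ _ _ D0 _ mF FB) _; last by rewrite ltry.
  by rewrite !mulr_ge0.
- rewrite /L2cvg.
  apply: (@squeeze_cvge _ _ _ _ (fun=> 0%E) _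
    (fun N => (2 * n%:R * (2 * b * 2^-1 ^+ N) * Num.sqrt D)%:E)).
  + near=> N; rewrite Lnorm_ge0 /= norm_tail //; near: N; exact: nbhs_infty_ge.
  + exact: cvg_cst.
  + apply/cvg_EFin; first by near=> N.
    rewrite /comp /=.
    have -> : (fun N => 2 * n%:R * (2 * b * 2^-1 ^+ N) * Num.sqrt D) =
      geometric (2 * n%:R * (2 * b) * Num.sqrt D) 2^-1.
      by apply/funext => N /=; ring.
    by apply: cvg_geometric; rewrite ger0_norm //; lra.
Unshelve. all: by end_near. Qed.

(** * Exponential decay of the whole series *)

Theorem theorem4 (R : realType) (M : nat) (hM : (1 <= M)%N)
  (D k : R) (hD : 0 < D) (hk : k = 2 * pi / D)
  (h : 'rV[R]_M.+1) (h_le0 : forall i, h 0 i <= 0)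
  (h_first : h 0 ord0 = 0) (h_last : h 0 ord_max != 0)
  (fhat : nat -> R -> 'cV[R[i]]_M.+1)
  (fhat0 : forall t : R, 0 <= t -> fhat 0%N t = e0 M)
  (fhat1_init : fhat 1%N 0 = e0 M)
  (fhat1_ode : forall t : R, 0 <= t ->
     exists2 df, is_vderiv_within `[0, +oo[ (fhat 1%N) t df &
       df + (0 +i* k) *: (cmx (matA M + (k ^+ 2)^-1 *: matG M) *m fhat 1%N t)
       = cmx (diag_mx h) *m fhat 1%N t)
  (fhat_init : forall m : nat, (2 <= m)%N -> fhat m 0 = 0)
  (fhat_ode : forall m : nat, (2 <= m)%N -> forall t : R, 0 <= t ->
     exists2 df, is_vderiv_within `[0, +oo[ (fhat m) t df &
       df + (0 +i* (m%:R * k)) *: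
              (cmx (matA M + ((m%:R * k) ^+ 2)^-1 *: matG M) *m fhat m t)
          + (0 +i* k^-1) *:
              (\sum_(1 <= l < m)
                 ((l%:R^-1)%:C * fhat l t ord0 0) *:
                   (cmx (matB M) *m fhat (m - l)%N t))
       = cmx (diag_mx h) *m fhat m t) :
  exists C3 lambda1 : R, 0 < lambda1 /\
    exists2 eps0 : R, 0 < eps0 & forall eps : R, 0 < eps < eps0 ->
      exists f : R -> R -> 'cV[R[i]]_M.+1, forall t : R, 0 <= t ->
        [/\ inL2 D (fun x => f x t),
            L2cvg D (fourier_sum k eps (fun m => fhat m t)) (fun x => f x t) &
            (L2norm D (fun x => f x t - fhat 0%N t)%R
               <= (C3 * (t ^+ M + 1) * expR (- lambda1 * t))%:E)%E].
Proof.
have k0 : 0 < k by rewrite hk divr_gt0 // mulr_gt0 // pi_gt0.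
have [mu [gam [rho [mu0 gam0 rho0 decay]]]] := coefficient_decay R M k k0 h h_le0
  h_last fhat fhat1_init fhat1_ode fhat_init fhat_ode.
(* Both constants are fixed before [eps]. The factor [2 * M.+1%:R] compares the Euclidean norm with
   coordinates, and [Num.sqrt D] the L2 norm with the supremum. *)
exists (2 * M.+1%:R * gam * Num.sqrt D), mu; split => //.
(* This threshold gives [eps * rho <= 2^-1], the ratio of the dominating geometric series. *)
exists (2 * rho)^-1; first by rewrite invr_gt0 mulr_gt0.
move=> eps /andP[eps0 epsl].
exists (fun x t => fourier_lim R M.+1 k eps (fun m => fhat m t) x) => t t0.
have er : eps * rho <= 2^-1.
  have -> : 2^-1 = (2 * rho)^-1 * rho by field; exact: lt0r_neq0.
  by rewrite ler_pM2r // ltW.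
have b0 : 0 <= gam * expR (- mu * t) by rewrite mulr_ge0 ?expR_ge0 // ltW.
have cb m i : (1 <= m)%N ->
    eps ^+ m * Normc.normc (fhat m t i 0) <= gam * expR (- mu * t) * 2^-1 ^+ m.
  move=> m1; apply: le_trans (ler_wpM2l (exprn_ge0 m (ltW eps0)) (decay m i t m1 t0)) _.
  rewrite [leLHS](_ : _ = gam * expR (- mu * t) * (eps * rho) ^+ m); last first.
    by rewrite exprMn; ring.
  by rewrite ler_wpM2l // lerXn2r ?nnegrE ?invr_ge0 ?mulr_ge0 ?(ltW eps0) ?(ltW rho0).
have [L2f cvgf normf] := fourier_series_L2 R M.+1 D k eps _ (fun m => fhat m t)
  hD (ltW eps0) b0 cb.
split => //; apply: le_trans normf _; rewrite lee_fin.
(* The explicit factor 1 is then enlarged to [t ^+ M + 1], using [t >= 0]. *)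
rewrite [leLHS](_ : _ = 2 * M.+1%:R * gam * Num.sqrt D * 1 * expR (- mu * t)); last by ring.
rewrite ler_wpM2r ?expR_ge0 // ler_wpM2l ?lerDr ?exprn_ge0 //.
by rewrite !mulr_ge0 ?sqrtr_ge0 // ltW.
Qed.
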